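(* Let $S=\{x\in\mathbb{R}^n: g(x)=0\}$ and $f$ satisfy the standing assumptions given in the context. Let $\Omega=\{x_j\}_{j=1}^J$ be the set of stationary points of the problem $\min_{x\in S}f(x)$ and $\Sigma=\{[x,\lambda_x]: x\in\Omega\}\subset\mathbb{R}^{n+m}$. Assume that the problem is nondegenerate and that the tangent Error Bound condition holds with constant $\mu>0$. Let $d>0$ and suppose that in the $d$-neighborhood of $\Omega$, i.e. on the set $\{x\in S:\rho(x,\Omega)<d\}$, the function $x\mapsto\lambda_x$ is Lipschitz continuous with constant $L_\lambda$ and the function $x\mapsto F'(x,\lambda_x)$ is Lipschitz continuous with constant $L_{1,Fx}>0$. Put $r=d\sqrt{1+L_\lambda^2}$ and suppose that $F'(z)$ is Lipschitz continuous with constant $L_{1,F}>0$ on $\{z\in\mathbb{R}^{n+m}:\rho(z,\Sigma)<2r\}$. Let $\sigma_0>0$ and $\beta\in(0,1)$ be constants such that $$\|F'(x_*,\lambda_{x_*})^{-1}\|\le\sigma_0\ \ \forall x_*\in\Omega,\qquad \beta\le L_{1,Fx}\,\sigma_0\, d,\qquad \frac{1-\beta}{2\sigma_0L_{1,F}}\le r .$$ Let $$C=\min\Big\{\frac{\mu\beta}{L_{1,Fx}\sigma_0},\ \frac{(1-\beta)^2}{4L_{1,F}\sigma_0^2}\Big\}.$$ Then for any starting point $x_0\in S$ (and the fixed step-size $0<\gamma<\min\{\frac1{L_1},\frac R{L_0}\}$ of the algorithm), the Combined Algorithm (described in the context) with the switching condition $\|P_{T_{x_k}}f'(x_k)\|\le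 C$, or with the other switching condition $\|x_k-x_{k-1}\|\le\frac{\gamma}{1+\gamma L_1}C$, converges to some stationary point $x_*\in\Omega$. Moreover, with $\Delta f=f(x_0)-\min_{x\in S}f(x)$, no more than $$N(\varepsilon)=N_1(C)+N_2(\varepsilon)=\left\lceil\frac{2\Delta f(1+\gamma L_1)^2}{C^2\gamma(1-\gamma L_1)}\right\rceil+\left\lceil\log_2\Big(\frac{C\sigma_0}{\varepsilon(1-\beta)}\Big)\right\rceil+1$$ steps of the Combined Algorithm are needed for the current point to be at distance at most $\varepsilon$ from $\Omega$; in particular, $N_1(C)=\left\lceil\frac{2\Delta f(1+\gamma L_1)^2}{C^2\gamma(1-\gamma L_1)}\right\rceil$ steps of Phase 1 (gradient projection) and $N_2(\varepsilon)=\left\lceil\log_2\big(\frac{C\sigma_0}{\varepsilon(1-\beta)}\big)\right\rceil+1$ steps of Phase 2 (modified Newton method) are needed.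
   Context: Setting and standing assumptions. $\mathbb{R}^n$ is Euclidean with norm $\|\cdot\|$; matrix norms are operator norms; $\rho(x,Q)=\inf_{y\in Q}\|x-y\|$; $P_S(x)$ is the metric projection of $x$ onto $S$ (the set of nearest points of $S$, identified with its element when it is a singleton). Let $m<n$, $f:\mathbb{R}^n\to\mathbb{R}$ and $g=(g_1,\dots,g_m):\mathbb{R}^n\to\mathbb{R}^m$ be twice continuously differentiable with Lipschitz continuous second derivatives $f'',g_i''$; $f$ is Lipschitz with constant $L_0>0$ and its gradient $f'$ (a column vector) is Lipschitz with constant $L_1>0$. The set $S=\{x:g(x)=0\}$ is compact, is a manifold without boundary, the Jacobi matrix $g'(x)\in\mathbb{R}^{m\times n}$ has rank $m$ at every $x\in S$, and $S$ is proximally smooth with constant $R>0$: the distance function $\rho(\cdot,S)$ is continuously differentiable on $\{x:0<\rho(x,S)<R\}$ (equivalently, every point of this set has a unique metric projection onto $S$, depending continuously on the point). Convention: for a number $t>0$, $\lceil t\rceil$ denotes the minimal natural number $N$ with $t\le N$. Notation. For $x\in S$, $T_x=\{v\in\mathbb{R}^n: g'(x)v=0\}$ and $P_{T_x}=I_n-g'(x)^T(g'(x)g'(x)^T)^{-1}g'(x)$ is the orthogonal projector onto $T_x$. The set of stationary points is $\Omega=\{x\in S:P_{T_x}f'(x)=0\}$. For $x\in S$ put $\lambda_x=-(g'(x)g'(x)^T)^{-1}g'(x)f'(x)\in\mathbb{R}^m$. For $z=[x,\lambda]\in\mathbb{R}^{n+m}$ (vertical stacking of columns) let $$F(z)=\begin{bmatrix}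 f'(x)+g'(x)^T\lambda\\ g(x)\end{bmatrix},\qquad F'(z)=\begin{bmatrix} f''(x)+\sum_{i=1}^m\lambda_i g_i''(x) & g'(x)^T\\ g'(x)&0\end{bmatrix},$$ and $F'(x,\lambda_x)$ denotes $F'(z)$ evaluated at $z=[x,\lambda_x]$. Nondegeneracy. The problem $\min_{x\in S}f(x)$ is nondegenerate if $F'(x_*,\lambda_{x_*})$ is invertible for all $x_*\in\Omega$ and the norms of these inverse matrices are bounded above by a common constant. Tangent Error Bound condition with constant $\mu>0$: $\mu\,\rho(x,\Omega)\le\|P_{T_x}f'(x)\|$ for all $x\in S$. Combined Algorithm. Phase 1 (gradient projection): starting from $x_0\in S$, with a fixed step-size $0<\gamma<\min\{\frac1{L_1},\frac R{L_0}\}$, compute $x_{k+1}=P_S(x_k-\gamma f'(x_k))$, increasing $k$; when the switching condition holds at the current $x_k$ (for the second switching condition, $k\ge1$), go to Phase 2. Phase 2 (modified Newton method): put $\widehat x_0=x_k$ (the last point of Phase 1), $\lambda_0=\lambda_{\widehat x_0}$, $z_0=[\widehat x_0,\lambda_0]$, and iterate $z_{k+1}=z_k-F'(z_0)^{-1}F(z_k)$, where $z_k=[\widehat x_k,\lambda_k]$, $k=0,1,\dots$. Convergence of the algorithm to $x_*$ means that the switch to Phase 2 occurs and $\widehat x_k\to x_*$.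
   Formalization: In the borderline case β = L_{1,Fx}σ₀d only, the two Lipschitz conditions (on λ_x and F'(x,λ_x)) are required on the closed set {x∈S: ρ(x,Ω) ≤ d} instead of ρ(x,Ω) < d; without this F'(z₀) can be singular at a switching point with ρ = d. *)

(* Defs.v *)
(* MathComp / MathComp-Analysis. *)
From HB Require Import structures.
From mathcomp Require Import all_boot all_order all_algebra.
From mathcomp Require Import all_classical all_reals all_analysis.

Set Implicit Arguments.
Unset Strict Implicit.
Unset Printing Implicit Defensive.

Import Order.TTheory GRing.Theory Num.Theory.
Import numFieldNormedType.Exports.

Local Open Scope classical_set_scope.
Local Open Scope ring_scope.

(* The library's norm on matrices is the max norm; it generates the usual
   topology, so compactness, continuity, differentiability and convergence are
   the library's, but distances and Lipschitz constants use the norms below. *)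
Definition enorm {R : realType} {p : nat} (v : 'cV[R]_p) : R :=
  Num.sqrt (\sum_i v i 0 ^+ 2).

Definition opnorm {R : realType} {p q : nat} (A : 'M[R]_(p, q)) : R :=
  sup [set enorm (A *m v) | v in [set v : 'cV[R]_q | enorm v <= 1]].

Definition dist {R : realType} {p : nat} (Q : set 'cV[R]_p) (x : 'cV[R]_p) : R :=
  inf [set enorm (x - y) | y in Q].

Definition lipschitz_wrt {R : realType} {U V : zmodType} (nU : U -> R)
    (nV : V -> R) (A : set U) (L : R) (h : U -> V) : Prop :=
  forall x y, A x -> A y -> nV (h x - h y) <= L * nU (x - y).

Definition grad {R : realType} {n : nat} (f : 'cV[R]_n -> R) (x : 'cV[R]_n)
    : 'cV[R]_n :=
  \col_i 'D_(delta_mx i 0) f x.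

(* The library's jacobian acts on row vectors and is the transpose of this
   p x n Jacobi matrix. *)
Definition jac {R : realType} {n p : nat} (h : 'cV[R]_n -> 'cV[R]_p)
    (x : 'cV[R]_n) : 'M[R]_(p, n) :=
  \matrix_(i, j) ('D_(delta_mx j 0) h x) i 0.

Definition hess {R : realType} {n : nat} (f : 'cV[R]_n -> R) (x : 'cV[R]_n)
    : 'M[R]_n :=
  jac (grad f) x.

Definition C2_lipschitz {R : realType} {n : nat} (f : 'cV[R]_n -> R) : Prop :=
  [/\ forall x, differentiable f x,
      forall x, differentiable (grad f) x,
      continuous (hess f)
    & exists L : R, lipschitz_wrt enorm opnorm setT L (hess f)].

Definition component {R : realType} {n m : nat} (g : 'cV[R]_n -> 'cV[R]_m)
    (i : 'I_m) (x : 'cV[R]_n) : R :=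
  g x i 0.

(* Every point of S has a relatively open neighbourhood in S homeomorphic to an
   open subset V of R^k, the homeomorphism being phi with inverse psi. *)
Definition manifold_without_boundary {R : realType} {n : nat} (k : nat)
    (S : set 'cV[R]_n) : Prop :=
  forall x, S x ->
  exists (U : set 'cV[R]_n) (V : set 'cV[R]_k)
         (phi : 'cV[R]_n -> 'cV[R]_k) (psi : 'cV[R]_k -> 'cV[R]_n),
    [/\ open U, U x, open V,
        (forall y, (S `&` U) y -> V (phi y) /\ psi (phi y) = y)
          /\ (forall v, V v -> (S `&` U) (psi v) /\ phi (psi v) = v)
      & {within S `&` U, continuous phi} /\ {within V, continuous psi}].

Definition proximally_smooth {R : realType} {n : nat} (S : set 'cV[R]_n)
    (rad : R) : Prop :=
  forall x, 0 < dist S x < rad ->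
    differentiable (dist S) x /\ {for x, continuous (grad (dist S))}.

Definition nearest {R : realType} {n : nat} (S : set 'cV[R]_n) (x : 'cV[R]_n)
    : set 'cV[R]_n :=
  [set y | S y /\ enorm (x - y) = dist S x].

(* Meaningful when nearest S x is a singleton. *)
Definition metric_proj {R : realType} {n : nat} (S : set 'cV[R]_n)
    (x : 'cV[R]_n) : 'cV[R]_n :=
  xget 0 (nearest S x).

Section Problem.
Context {R : realType} {n m : nat}.
Variables (f : 'cV[R]_n -> R) (g : 'cV[R]_n -> 'cV[R]_m).
Implicit Types (x : 'cV[R]_n) (z : 'cV[R]_(n + m)).

Definition feasible : set 'cV[R]_n := [set x | g x = 0].

Definition proj_tangent x : 'M[R]_n :=
  1%:M - (jac g x)^T *m invmx (jac g x *m (jac g x)^T) *m jac g x.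

Definition stationary : set 'cV[R]_n :=
  [set x | feasible x /\ proj_tangent x *m grad f x = 0].

Definition multiplier x : 'cV[R]_m :=
  - (invmx (jac g x *m (jac g x)^T) *m jac g x *m grad f x).

Definition lift_multiplier x : 'cV[R]_(n + m) := col_mx x (multiplier x).

Definition KKT z : 'cV[R]_(n + m) :=
  col_mx (grad f (usubmx z) + (jac g (usubmx z))^T *m dsubmx z)
         (g (usubmx z)).

Definition KKT' z : 'M[R]_(n + m) :=
  block_mx
    (hess f (usubmx z)
       + \sum_i dsubmx z i 0 *: hess (component g i) (usubmx z))
    (jac g (usubmx z))^T
    (jac g (usubmx z))
    0.

Definition nondegenerate_problem : Prop :=
  (forall x, stationary x -> KKT' (lift_multiplier x) \in unitmx) /\
  (exists M : R, forall x, stationary x ->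
     opnorm (invmx (KKT' (lift_multiplier x))) <= M).

Definition tangent_error_bound (mu : R) : Prop :=
  forall x, feasible x ->
    mu * dist stationary x <= enorm (proj_tangent x *m grad f x).

Definition grad_proj_seq (gamma : R) (x0 : 'cV[R]_n) (k : nat) : 'cV[R]_n :=
  iter k (fun x => metric_proj feasible (x - gamma *: grad f x)) x0.

(* KKT' z0 has to be invertible: invmx A is A itself for a singular A. *)
Definition newton_seq z0 (k : nat) : 'cV[R]_(n + m) :=
  iter k (fun z => z - invmx (KKT' z0) *m KKT z) z0.

Definition switch_grad (C : R) (x : nat -> 'cV[R]_n) (k : nat) : Prop :=
  enorm (proj_tangent (x k) *m grad f (x k)) <= C.

Definition switch_step (gamma L1 C : R) (x : nat -> 'cV[R]_n) (k : nat)
    : Prop :=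
  (1 <= k)%N /\ enorm (x k - x k.-1) <= gamma / (1 + gamma * L1) * C.

End Problem.

(* The current point after t steps in all, K of which belong to Phase 1. *)
Definition combined_seq {T : Type} (K : nat) (x xh : nat -> T) (t : nat) : T :=
  if (t < K)%N then x t else xh (t - K)%N.

Definition log2 {R : realType} (t : R) : R := ln t / ln 2.

Lemma natceil_subproof {R : realType} (t : R) :
  exists N : nat, (1 <= N)%N && (t <= N%:R).
Proof.
exists (Num.bound `|t|).+1; rewrite ltnS leq0n /=.
have lt_t : `|t| < (Num.bound `|t|)%:R by apply: archi_boundP.
by rewrite (le_trans (ler_norm t))// (le_trans (ltW lt_t))// ler_nat.
Qed.

(* The natural numbers of this ceiling start at 1. This is immaterial for
   t > 0; for t <= 0 the value is 1. *)
Definition natceil {R : realType} (t : R) : nat := ex_minn (natceil_subproof t).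

(* Main.v *)
(** Phase 1: each projected gradient step decreases f by at least
    (1 - gamma L1) / (2 gamma) times its squared length, and since the new point
    is a nearest point of S, the projection of the old gradient onto the new
    tangent space is the projected step divided by - gamma; so a short step means
    a small projected gradient, and the number of long steps is bounded.
    Phase 2: the error bound places the switching point near a stationary point,
    where F' is invertible by perturbation; there the modified Newton map is a
    contraction with factor 1/2, whose fixed point is a zero of F.
    The first-order condition at a nearest point needs no implicit function
    theorem: the same Newton iteration corrects the point x + t v to a feasible
    one at distance o(t) from it.  Stationary points exist since a minimiser of f
    on S is fixed by the projected gradient step. *)

Require Import Defs.
From HB Require Import structures.
From mathcomp Require Import all_boot all_order all_algebra.
From mathcomp Require Import all_classical all_reals all_analysis.
From mathcomp Require Import ring lra.

Import Order.TTheory GRing.Theory Num.Theory.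
Import numFieldNormedType.Exports.

Local Open Scope classical_set_scope.
Local Open Scope ring_scope.

Set Implicit Arguments.
Unset Strict Implicit.

(** * Euclidean and operator norms *)

Section Euclid.
Context {R : realType}.

Definition edot {p : nat} (u v : 'cV[R]_p) : R := \sum_i u i 0 * v i 0.

Lemma edotC p (u v : 'cV[R]_p) : edot u v = edot v u.
Proof. by apply: eq_bigr => i _; rewrite mulrC. Qed.

Lemma edotDl p (u v w : 'cV[R]_p) : edot (u + v) w = edot u w + edot v w.
Proof. by rewrite -big_split; apply: eq_bigr => i _; rewrite mxE mulrDl. Qed.

Lemma edotZl p a (u v : 'cV[R]_p) : edot (a *: u) v = a * edot u v.
Proof. by rewrite mulr_sumr; apply: eq_bigr => i _; rewrite mxE mulrA. Qed.

Lemma edotDr p (u v w : 'cV[R]_p) : edot w (u + v) = edot w u + edot w v.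
Proof. by rewrite edotC edotDl !(edotC w). Qed.

Lemma edotZr p a (u v : 'cV[R]_p) : edot v (a *: u) = a * edot v u.
Proof. by rewrite edotC edotZl (edotC v). Qed.

Lemma edotNl p (u v : 'cV[R]_p) : edot (- u) v = - edot u v.
Proof. by rewrite -scaleN1r edotZl mulN1r. Qed.

Lemma edotNr p (u v : 'cV[R]_p) : edot u (- v) = - edot u v.
Proof. by rewrite edotC edotNl edotC. Qed.

Lemma edot0l p (u : 'cV[R]_p) : edot 0 u = 0.
Proof. by rewrite -(scale0r u) edotZl mul0r. Qed.

Definition edotE := (edotDl, edotDr, edotNl, edotNr, edotZl, edotZr).

Lemma edot_mulmx p q (A : 'M[R]_(p, q)) (u : 'cV[R]_q) (v : 'cV[R]_p) :
  edot (A *m u) v = edot u (A^T *m v).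
Proof.
rewrite /edot; under eq_bigr do rewrite mxE mulr_suml.
rewrite exchange_big/=; apply: eq_bigr => j _; rewrite mxE mulr_sumr.
by apply: eq_bigr => i _; rewrite mxE mulrCA mulrA.
Qed.

Lemma enorm_ge0 p (u : 'cV[R]_p) : 0 <= enorm u.
Proof. exact: sqrtr_ge0. Qed.

Lemma enorm_sqr p (u : 'cV[R]_p) : enorm u ^+ 2 = edot u u.
Proof.
rewrite sqr_sqrtr; last by apply: sumr_ge0 => i _; exact: sqr_ge0.
by apply: eq_bigr => i _; rewrite expr2.
Qed.

Lemma ler_sqr2 (a b : R) : 0 <= b -> a ^+ 2 <= b ^+ 2 -> a <= b.
Proof. by move=> b0 ab; have [a0|/ltW/le_trans ->//] := leP 0 a; rewrite -ler_sqr. Qed.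

Lemma enormZ p a (u : 'cV[R]_p) : enorm (a *: u) = `|a| * enorm u.
Proof.
apply/eqP; rewrite -(@eqrXn2 _ 2)// ?mulr_ge0 ?enorm_ge0//.
by rewrite exprMn !enorm_sqr !edotE real_normK ?num_real//; apply/eqP; ring.
Qed.

Lemma enormN p (u : 'cV[R]_p) : enorm (- u) = enorm u.
Proof. by rewrite -scaleN1r enormZ normrN1 mul1r. Qed.

Lemma enormB p (u v : 'cV[R]_p) : enorm (u - v) = enorm (v - u).
Proof. by rewrite -opprB enormN. Qed.

Lemma enorm0 p : enorm (0 : 'cV[R]_p) = 0.
Proof. by rewrite -(scale0r 0) enormZ normr0 mul0r. Qed.

Lemma coord_le_enorm p (u : 'cV[R]_p) i : `|u i 0| <= enorm u.
Proof.
apply: ler_sqr2; first exact: enorm_ge0.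
rewrite enorm_sqr real_normK ?num_real// /edot (bigD1 i)//= expr2 lerDl.
by apply: sumr_ge0 => j _; rewrite -expr2 sqr_ge0.
Qed.

Lemma enorm_eq0 p (u : 'cV[R]_p) : enorm u = 0 -> u = 0.
Proof.
move=> u0; apply/matrixP => i j; rewrite (ord1 j) mxE.
by apply/eqP; rewrite -normr_le0 -u0 coord_le_enorm.
Qed.

(** Expanding the squared norm of [enorm v *: u - enorm u *: v] gives the inequality multiplied by
    [enorm u * enorm v], so the vanishing cases are split off first. *)
Lemma cauchy_schwarz p (u v : 'cV[R]_p) : edot u v <= enorm u * enorm v.
Proof.
have [/enorm_eq0 ->|u0] := eqVneq (enorm u) 0.
  by rewrite edot0l mulr_ge0 ?enorm_ge0.
have [/enorm_eq0 ->|v0] := eqVneq (enorm v) 0.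
  by rewrite edotC edot0l mulr_ge0 ?enorm_ge0.
have uv0 : 0 < enorm u * enorm v by rewrite mulr_gt0// lt0r ?u0 ?v0 enorm_ge0.
rewrite -(ler_pM2l uv0).
have := sqr_ge0 (enorm (enorm v *: u - enorm u *: v)).
rewrite enorm_sqr !edotE (edotC v u) -!enorm_sqr.
lra.
Qed.

Lemma ler_norm_edot p (u v : 'cV[R]_p) : `|edot u v| <= enorm u * enorm v.
Proof.
by rewrite ler_norml cauchy_schwarz lerNl -edotNl -(enormN u) cauchy_schwarz.
Qed.

Lemma ler_enormD p (u v : 'cV[R]_p) : enorm (u + v) <= enorm u + enorm v.
Proof.
apply: ler_sqr2; first by rewrite addr_ge0 ?enorm_ge0.
rewrite enorm_sqr !edotE (edotC v u) -!enorm_sqr.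
have := cauchy_schwarz u v; lra.
Qed.

Lemma enormD_sqr p (u v : 'cV[R]_p) :
  enorm (u + v) ^+ 2 = enorm u ^+ 2 + 2 * edot u v + enorm v ^+ 2.
Proof. by rewrite !enorm_sqr !edotE (edotC v); ring. Qed.

Lemma ler_enorm_dist p (u v w : 'cV[R]_p) :
  enorm (u - w) <= enorm (u - v) + enorm (v - w).
Proof. by apply: le_trans (ler_enormD _ _); rewrite addrA subrK. Qed.

Lemma ler_dist_enorm p (u v : 'cV[R]_p) : `|enorm u - enorm v| <= enorm (u - v).
Proof.
have := ler_enormD (u - v) v; have := ler_enormD (v - u) u.
by rewrite !subrK (enormB v u) ler_norml; lra.
Qed.

(** * Comparison with the max norm and its topology *)

Lemma normr_le_enorm p (u : 'cV[R]_p) : `|u| <= enorm u.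
Proof.
rewrite [leLHS]/Num.Def.normr/= mx_normrE.
by apply: bigmax_le => [|[i j] _]; rewrite ?enorm_ge0//= (ord1 j) coord_le_enorm.
Qed.

Lemma enorm_le_normr p (u : 'cV[R]_p) : enorm u <= p%:R * `|u|.
Proof.
apply: ler_sqr2; first by rewrite mulr_ge0.
rewrite enorm_sqr (@le_trans _ _ (\sum_(i < p) `|u| ^+ 2))//.
  apply: ler_sum => i _; rewrite -expr2 -real_normK ?num_real// lerXn2r ?nnegrE//.
  rewrite [leRHS]/Num.Def.normr/= mx_normrE.
  exact: (le_bigmax _ (fun x => `|u x.1 x.2|) (i, 0)).
rewrite sumr_const card_ord exprMn -[leLHS]mulr_natl ler_wpM2r ?sqr_ge0//.
by rewrite -natrX ler_nat; case: (p) => // k; rewrite expnS expn1 leq_pmull.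
Qed.

Lemma enorm_cvgP p (u : nat -> 'cV[R]_p) (l : 'cV[R]_p) :
  (forall e, 0 < e -> \forall k \near \oo, enorm (u k - l) <= e) ->
  u @ \oo --> l.
Proof.
move=> h; apply/cvgrPdist_le => /= e e0.
apply: filterS (h e e0) => k; apply: le_trans.
by rewrite -normrN opprB normr_le_enorm.
Qed.

Lemma enorm_near p (x : 'cV[R]_p) (e : R) : 0 < e ->
  \forall y \near x, enorm (y - x) < e.
Proof.
(* The divisor [p.+1] stays positive when [p = 0]. *)
move=> e0; have p1 : 0 < (p.+1)%:R :> R by rewrite ltr0n.
have := nbhsx_ballx x _ (divr_gt0 e0 p1).
apply: filterS => y /=; rewrite -ball_normE /= => xy.
rewrite enormB (le_lt_trans (enorm_le_normr _))//.
move: xy; rewrite ltr_pdivlMr//; apply: le_lt_trans.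
by rewrite mulrC ler_wpM2l// ler_nat.
Qed.

Lemma near_enorm p (x : 'cV[R]_p) (P : set 'cV[R]_p) :
  (\forall y \near x, P y) -> exists2 e : R, 0 < e & forall y, enorm (y - x) < e -> P y.
Proof.
move=> /nbhs_ballP[e /= e0 he]; exists e => // y yx; apply: he.
rewrite -ball_normE /= -normrN opprB.
by rewrite (le_lt_trans (normr_le_enorm _)).
Qed.

Lemma lipschitz_continuous_enorm p (h : 'cV[R]_p -> R) (K : R) :
  (forall x y, `|h x - h y| <= K * enorm (x - y)) -> continuous h.
Proof.
move=> hK x; apply: (iffRL (@cvgrPdist_lt _ _ _ _ (nbhs_filter x) _ _)) => e e0.
have K1 : 0 < `|K| + 1 by rewrite ltr_wpDl.
have := enorm_near x (divr_gt0 e0 K1); apply: filterS => y.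
rewrite ltr_pdivlMr// -normrN opprB; apply: le_lt_trans.
apply: le_trans (hK _ _) _; rewrite mulrC ler_wpM2l ?enorm_ge0//.
by rewrite (le_trans (ler_norm K))// lerDl.
Qed.

(** * Operator norm and perturbation of inverses *)

Lemma enorm_mulmx_bounded p q (A : 'M[R]_(p, q)) :
  exists2 M, 0 <= M & forall v, enorm (A *m v) <= M * enorm v.
Proof.
(* The Frobenius norm works, by Cauchy-Schwarz on each row. This finiteness makes the supremum in
   [opnorm] a genuine one. *)
exists (Num.sqrt (\sum_i enorm (row i A)^T ^+ 2)) => [|v]; first exact: sqrtr_ge0.
apply: ler_sqr2; first by rewrite mulr_ge0 ?sqrtr_ge0 ?enorm_ge0.
rewrite exprMn enorm_sqr [X in _ <= X * _]sqr_sqrtr; last first.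
  by apply: sumr_ge0 => i _; exact: sqr_ge0.
rewrite mulr_suml; apply: ler_sum => i _.
rewrite -expr2 -exprMn -real_normK ?num_real// lerXn2r ?nnegrE ?mulr_ge0 ?enorm_ge0//.
apply: le_trans (ler_norm_edot _ _); rewrite mxE le_eqVlt; apply/orP; left.
by apply/eqP; congr `|_|; apply: eq_bigr => j _; rewrite !mxE.
Qed.

Lemma has_sup_opnorm p q (A : 'M[R]_(p, q)) :
  has_sup [set enorm (A *m v) | v in [set v : 'cV[R]_q | enorm v <= 1]].
Proof.
have [M M0 hM] := enorm_mulmx_bounded A; split.
  by exists (enorm (A *m 0)), 0; rewrite //= enorm0.
exists M => _ [v /= v1 <-]; rewrite (le_trans (hM v))//.
by rewrite -[leRHS]mulr1 ler_wpM2l.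
Qed.

Lemma enorm_mulmx_le p q (A : 'M[R]_(p, q)) v :
  enorm (A *m v) <= opnorm A * enorm v.
Proof.
have [/enorm_eq0 ->|v0] := eqVneq (enorm v) 0.
  by rewrite mulmx0 !enorm0 mulr0.
have {}v0 : 0 < enorm v by rewrite lt0r v0 enorm_ge0.
rewrite -ler_pdivrMr//; apply: (sup_upper_bound (has_sup_opnorm A)).
exists ((enorm v)^-1 *: v) => /=; rewrite -?scalemxAr enormZ gtr0_norm ?invr_gt0//.
  by rewrite mulVf// gt_eqF.
by rewrite mulrC.
Qed.

Lemma unitmx_inj p (A : 'M[R]_p) :
  (forall v : 'cV[R]_p, A *m v = 0 -> v = 0) -> A \in unitmx.
Proof.
move=> Ainj; rewrite -unitmx_tr -row_free_unit -kermx_eq0.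
apply/eqP/row_matrixP => i; rewrite row0; apply: trmx_inj; rewrite trmx0.
apply: Ainj; have -> : A *m (row i (kermx A^T))^T = (row i (kermx A^T) *m A^T)^T.
  by rewrite trmx_mul trmxK.
by rewrite -row_mul mulmx_ker row0 trmx0.
Qed.

(* Neumann's perturbation lemma, the source of the factor sigma0 / (1 - beta). *)
Lemma unitmx_perturb p (A B : 'M[R]_p) (s b : R) :
  A \in unitmx -> 0 < s -> 0 <= b < 1 ->
  opnorm (invmx A) <= s -> opnorm (B - A) <= b / s ->
  B \in unitmx /\ forall v, enorm (invmx B *m v) <= s / (1 - b) * enorm v.
Proof.
move=> Au s0 /andP[b0 b1] As BA.
(* This lower bound yields both the injectivity of [B] and the bound on its inverse. *)
have key v : (1 - b) * enorm v <= s * enorm (B *m v).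
  have -> : B *m v = A *m v + (B - A) *m v by rewrite mulmxBl addrC subrK.
  have h1 : enorm v <= s * enorm (A *m v).
    rewrite -{1}(mulKmx Au v) (le_trans (enorm_mulmx_le _ _))//.
    by rewrite ler_wpM2r// enorm_ge0.
  have h2 : s * enorm ((B - A) *m v) <= b * enorm v.
    rewrite -[b](divfK (lt0r_neq0 s0)) mulrAC [leRHS]mulrC ler_wpM2l ?(ltW s0)//.
    by rewrite (le_trans (enorm_mulmx_le _ _))// ler_wpM2r// enorm_ge0.
  have := ler_enormD (A *m v + (B - A) *m v) (- ((B - A) *m v)).
  rewrite addrK enormN; rewrite -(ler_pM2l s0); lra.
have b1' : 0 < 1 - b by rewrite subr_gt0.
have Bu : B \in unitmx.
  apply: unitmx_inj => v Bv0; apply: enorm_eq0; apply/eqP.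
  have := key v; rewrite Bv0 enorm0 mulr0 pmulr_rle0// => v0.
  by rewrite eq_le v0 enorm_ge0.
split=> // v; rewrite mulrAC ler_pdivlMr// mulrC (le_trans (key _))//.
by rewrite mulKVmx.
Qed.

End Euclid.

(** * Distance and nearest points *)

Section Distance.
Context {R : realType} {p : nat}.
Implicit Types (Q S : set 'cV[R]_p) (x y : 'cV[R]_p).

Lemma has_lbound_dist Q x : has_lbound [set enorm (x - y) | y in Q].
Proof. by exists 0 => _ [y _ <-]; exact: enorm_ge0. Qed.

Lemma dist_le Q x y : Q y -> dist Q x <= enorm (x - y).
Proof. by move=> Qy; apply: (ge_inf (has_lbound_dist Q x)); exists y. Qed.

Lemma dist_ge Q x c : Q !=set0 -> (forall y, Q y -> c <= enorm (x - y)) ->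
  c <= dist Q x.
Proof.
move=> [y Qy] h; apply: lb_le_inf; first by exists (enorm (x - y)), y.
by move=> _ [z Qz <-]; exact: h.
Qed.

Lemma dist_ge0 Q x : 0 <= dist Q x.
Proof.
(* The infimum over the empty set is 0 by default. *)
have [->|/set0P Q0] := eqVneq Q set0; first by rewrite /dist image_set0 inf0.
by apply: dist_ge => // y _; exact: enorm_ge0.
Qed.

Lemma dist_mem Q x : Q x -> dist Q x = 0.
Proof.
move=> Qx; apply/eqP; rewrite eq_le dist_ge0 andbT.
by apply: le_trans (dist_le x Qx) _; rewrite subrr enorm0.
Qed.

Lemma dist_triangle Q x y : Q !=set0 -> dist Q x <= enorm (x - y) + dist Q y.
Proof.
move=> Q0; rewrite -lerBlDl; apply: dist_ge => // z Qz.
rewrite lerBlDl; exact: le_trans (dist_le x Qz) (ler_enorm_dist _ _ _).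
Qed.

Lemma nearest_exists Q x : compact Q -> Q !=set0 -> nearest Q x !=set0.
Proof.
move=> cQ Q0.
have cf : {within Q, continuous (fun y => enorm (x - y))}.
  apply: continuous_subspaceT; apply: (@lipschitz_continuous_enorm _ _ _ 1) => u v.
  rewrite mul1r (le_trans (ler_dist_enorm _ _))// opprB addrC subrKA.
  by rewrite enormB.
have [y /set_mem Qy hy] := compact_EVT_min Q0 cQ cf.
exists y; split=> //; apply/eqP; rewrite eq_le dist_le// andbT.
by apply: dist_ge => // z Qz; apply: hy; exact/mem_set.
Qed.

(** The two-sided limit defining the derivative equals its limit from the right, so difference
    quotients at small positive [t] decide. *)
Lemma derive_le (h : 'cV[R]_p -> R) x v c e : 0 < e -> derivable h x v ->
  (forall t, 0 < t < e -> h (x + t *: v) <= h x + t * c) -> 'D_v h x <= c.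
Proof.
move=> e0 dh hle; move/cvg_ex : (dh) => [l hl].
have -> : 'D_v h x = l by exact/cvg_lim.
apply: (cvgr_to_le (cvg_dnbhs_at_right hl)).
near=> t.
have t0 : 0 < t by near: t; exact: nbhs_right_gt.
have te : t < e by near: t; exact: nbhs_right_lt.
rewrite /= ler_pdivrMl// lerBlDl.
by have := hle t; rewrite t0 te [x + _]addrC; apply.
Unshelve. all: by end_near. Qed.

Lemma derive_ge (h : 'cV[R]_p -> R) x v c e : 0 < e -> derivable h x v ->
  (forall t, 0 < t < e -> h x + t * c <= h (x + t *: v)) -> c <= 'D_v h x.
Proof.
move=> e0 dh hge; rewrite -lerN2 -deriveN//.
apply: (derive_le e0); first exact: derivableN.
by move=> t te; rewrite mulrN -opprD lerN2 hge.
Qed.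

(* Along the unit vector towards any nearest point the distance has derivative -1,
   while its derivatives are at least minus the length; strict convexity of the
   Euclidean ball leaves room for one such unit vector only. *)
Lemma nearest_unique S x : S !=set0 -> 0 < dist S x -> differentiable (dist S) x ->
  forall y z, nearest S x y -> nearest S x z -> y = z.
Proof.
move=> S0 d0 df y z [Sy ny] [Sz nz]; set D := dist S x in d0 ny nz.
have Dn0 : D != 0 by rewrite gt_eqF.
pose u w := D^-1 *: (w - x).
have u1 w : enorm (x - w) = D -> edot (u w) (u w) = 1.
  move=> xw; rewrite -enorm_sqr enormZ gtr0_norm ?invr_gt0// enormB xw.
  by rewrite mulVf// expr1n.
have du w : S w -> enorm (x - w) = D -> 'D_(u w) (dist S) x <= -1.
  move=> Sw xw; apply: (derive_le d0); first exact: diff_derivable.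
  move=> t /andP[t0 tD]; apply: le_trans (dist_le _ Sw) _.
  have -> : x + t *: u w - w = (1 - t / D) *: (x - w).
    by rewrite /u scalerA scalerBl scale1r -[w - x]opprB scalerN addrAC.
  rewrite enormZ xw ger0_norm ?subr_ge0 ?ler_pdivrMr ?mul1r ?(ltW tD)//.
  by rewrite mulrBl mul1r mulfVK// mulrN1.
have dge w : - enorm w <= 'D_w (dist S) x.
  apply: (derive_ge ltr01); first exact: diff_derivable.
  move=> t /andP[t0 _]; rewrite mulrN lerBlDr addrC.
  have := @dist_triangle S x (x + t *: w) S0.
  by rewrite opprD addrA subrr add0r enormN enormZ gtr0_norm.
(* By linearity the derivative along [u y + u z] is at most -2, and it is at least minus the length
   of that vector. *)
have : 2 <= enorm (u y + u z).
  have := dge (u y + u z); have := du _ Sy ny; have := du _ Sz nz.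
  rewrite !deriveE// linearD; lra.
rewrite -ler_sqr ?nnegrE ?enorm_ge0// enorm_sqr edotDl !edotDr (u1 _ ny) (u1 _ nz).
rewrite (edotC (u z)) => h4.
have : enorm (u y - u z) ^+ 2 <= 0.
  rewrite enorm_sqr edotDl !edotDr !edotNl !edotNr (u1 _ ny) (u1 _ nz).
  by rewrite (edotC (u z)); lra.
rewrite real_exprn_even_le0 ?num_real//= => /eqP/enorm_eq0/eqP.
by rewrite subr_eq0 => /eqP/(scalerI (invr_neq0 Dn0))/addIr.
Qed.

(** At positive distance, differentiability of the distance gives uniqueness; at distance 0, where
    proximal smoothness is silent, the only nearest point is [x] itself. *)
Lemma nearest_metric_proj S rad x : compact S -> S !=set0 ->
  proximally_smooth S rad -> dist S x < rad ->
  nearest S x = [set metric_proj S x].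
Proof.
move=> cS S0 Srad xrad; have [y ny] := nearest_exists x cS S0.
have uniq z w : nearest S x z -> nearest S x w -> z = w.
  have [d0|d0] := ltP 0 (dist S x).
    by apply: nearest_unique => //; have [] := Srad x _; rewrite // d0.
  have {}d0 : dist S x = 0 by apply/eqP; rewrite eq_le d0 dist_ge0.
  move=> [_] + [_]; rewrite d0 => /enorm_eq0/eqP + /enorm_eq0/eqP.
  by rewrite !subr_eq0 => /eqP <- /eqP <-.
apply/seteqP; split => z /=.
  by move=> nz; apply: (uniq _ _ nz); exact: xgetI nz.
by move=> ->; exact: xgetI ny.
Qed.

End Distance.

(** * Mean value inequalities *)

Section Calculus.
Context {R : realType}.

Lemma is_derive_line {V W : normedModType R} (h : V -> W) w v t :
  differentiable h (w + t *: v) ->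
  is_derive (t : R) 1 (fun s => h (w + s *: v)) ('D_v h (w + t *: v)).
Proof.
move=> dh.
have E : (fun e : R => e^-1 *: (h (w + (e *: 1 + t) *: v) - h (w + t *: v))) =
    (fun e : R => e^-1 *: (h (e *: v + (w + t *: v)) - h (w + t *: v))).
  by apply/funext => e; rewrite [e *: 1]mulr1 scalerDl addrCA.
apply: DeriveDef; last by rewrite /derive /= E.
rewrite /derivable /= E; exact: diff_derivable.
Qed.

Lemma is_derive_mulr (c t : R) : is_derive t 1 (fun s => s * c) c.
Proof.
have -> : (fun s => s * c) = c *: (id : R -> R).
  by apply/funext => s; rewrite /= mulrC.
by apply: is_derive_eq; rewrite [_ *: _]mulr1.
Qed.

Lemma is_derive_sqr_mulr (c t : R) :
  is_derive t 1 (fun s => s ^+ 2 * c) (2 * t * c).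
Proof.
have -> : (fun s => s ^+ 2 * c) = c *: ((id : R -> R) ^+ 2).
  by apply/funext => s; rewrite /= mulrC.
by apply: is_derive_eq; rewrite /= expr1 [_ *: 1]mulr1 [LHS]mulrC.
Qed.

Lemma mean_value (phi dphi : R -> R) :
  (forall t : R, is_derive t 1 phi (dphi t)) ->
  exists2 c, 0 <= c <= 1 & phi 1 - phi 0 = dphi c.
Proof.
move=> dp.
have cphi : {within `[(0 : R), 1], continuous phi}.
  apply: continuous_subspaceT => t; apply: differentiable_continuous.
  by apply/derivable1_diffP.
have [c c01 ->] := MVT_segment ler01 (fun t _ => dp t) cphi.
by exists c; rewrite ?subr0 ?mulr1//; move: c01; rewrite in_itv.
Qed.

Lemma derive_jac n p (h : 'cV[R]_n -> 'cV[R]_p) x v : differentiable h x ->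
  'D_v h x = jac h x *m v.
Proof.
move=> dh; rewrite deriveE// [v in LHS]matrix_sum_delta linear_sum.
apply/matrixP => i j; rewrite (ord1 j) summxE mxE; apply: eq_bigr => k _.
by rewrite big_ord1 linearZ mxE -deriveE// mxE mulrC.
Qed.

Lemma derive_grad n (h : 'cV[R]_n -> R) x v : differentiable h x ->
  'D_v h x = edot (grad h x) v.
Proof.
move=> dh; rewrite deriveE// [v in LHS]matrix_sum_delta linear_sum.
apply: eq_bigr => k _.
by rewrite big_ord1 linearZ -deriveE// mxE mulrC.
Qed.

(** In place of an integral remainder: subtracting the linear and quadratic terms along the segment
    leaves a function of [t] whose derivative is non-positive on [0,1], and the mean value theorem
    applies. *)
Lemma descent n (f : 'cV[R]_n -> R) L x s : (forall x, differentiable f x) ->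
  lipschitz_wrt enorm enorm setT L (grad f) ->
  f (x + s) <= f x + edot (grad f x) s + L / 2 * enorm s ^+ 2.
Proof.
move=> df fL.
pose c := edot (grad f x) s; pose q := L / 2 * enorm s ^+ 2.
pose phi t := f (x + t *: s) - t * c - t ^+ 2 * q.
have dphi (t : R) : is_derive t 1 phi (edot (grad f (x + t *: s)) s - c - 2 * t * q).
  rewrite -derive_grad//.
  have := is_derive_line (df (x + t *: s)) => D.
  have -> : phi = (fun t => f (x + t *: s)) - (fun t => t * c)
     - (fun t => t ^+ 2 * q) by [].
  apply: is_deriveB; last exact: is_derive_sqr_mulr.
  by apply: is_deriveB; exact: is_derive_mulr.
have [t /andP[t0 t1] E] := mean_value dphi.
have := cauchy_schwarz (grad f (x + t *: s) - grad f x) s.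
rewrite edotDl edotNl -/c => h1.
have := fL (x + t *: s) x Logic.I Logic.I.
rewrite addrAC subrr add0r enormZ ger0_norm// => h2.
have h3 : edot (grad f (x + t *: s)) s - c <= 2 * t * q.
  apply: le_trans h1 _; rewrite (le_trans (ler_wpM2r (enorm_ge0 _) h2))//.
  by rewrite /q; lra.
move: E; rewrite /phi scale1r scale0r addr0 /q => E.
have : f (x + s) - 1 * c - 1 ^+ 2 * q - (f x - 0 * c - 0 ^+ 2 * q) <= 0.
  by rewrite E subr_le0.
rewrite /q; lra.
Qed.

(* Testing the increment against itself reduces the mean value inequality for
   vector-valued functions to the scalar mean value theorem. *)
Lemma mean_value_vector q p (F : 'cV[R]_q -> 'cV[R]_p) (J : 'cV[R]_q -> 'M[R]_(p, q))
    (A : 'M[R]_(p, q)) (z w z0 : 'cV[R]_q) (rho K : R) :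
  (forall t i, is_derive (t : R) 1 (fun s => F (w + s *: (z - w)) i 0)
    ((J (w + t *: (z - w)) *m (z - w)) i 0)) ->
  enorm (z - z0) <= rho -> enorm (w - z0) <= rho ->
  (forall y, enorm (y - z0) <= rho ->
    enorm ((J y - A) *m (z - w)) <= K * enorm (z - w)) ->
  enorm (F z - F w - A *m (z - w)) <= K * enorm (z - w).
Proof.
move=> dF zr wr hK; set v := z - w; set u := F z - F w - A *m v.
pose phi t := edot u (F (w + t *: v) - t *: (A *m v)).
have dphi (t : R) : is_derive t 1 phi (edot u ((J (w + t *: v) - A) *m v)).
  have -> : phi = \sum_i (u i 0 *: ((fun s => F (w + s *: v) i 0) -
                             (fun s => s * (A *m v) i 0))).
    apply/funext => s; rewrite /phi fct_sumE; apply: eq_bigr => i _.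
    by rewrite !mxE.
  apply: (@is_derive_eq _ _ _ _ _ _ _ (\sum_i u i 0 *: ((J (w + t *: v) *m v) i 0
      - (A *m v) i 0))); last first.
    by apply: eq_bigr => i _; rewrite mulmxBl !mxE.
  apply: is_derive_sum => i; apply: is_deriveZ; apply: is_deriveB.
  exact: is_derive_mulr.
have [t /andP[t0 t1]] := mean_value dphi.
have -> : phi 1 - phi 0 = edot u u.
  rewrite /phi !scale1r !scale0r addr0 subr0 -edotNr -edotDr; congr (edot u _).
  by rewrite /v [w + (z - w)]addrC subrK /u addrAC.
have tr : enorm (w + t *: v - z0) <= rho.
  have -> : w + t *: v - z0 = t *: (z - z0) + (1 - t) *: (w - z0).
    by apply/matrixP => i j; rewrite /v !mxE; ring.
  rewrite (le_trans (ler_enormD _ _))// !enormZ !ger0_norm ?subr_ge0//.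
  have := ler_wpM2l t0 zr; have : (1 - t) * enorm (w - z0) <= (1 - t) * rho.
    by rewrite ler_wpM2l// subr_ge0.
  lra.
rewrite -enorm_sqr => E.
have := cauchy_schwarz u ((J (w + t *: v) - A) *m v); rewrite -E => h1.
(* For [u = 0] the right-hand side is nonnegative by [hK] at [z]; the sign of [K] is not given. *)
have [->|u0] := eqVneq (enorm u) 0.
  exact: le_trans (enorm_ge0 _) (hK z zr).
apply: le_trans (hK _ tr); move: h1; rewrite expr2 ler_pM2l//.
by rewrite lt0r u0 enorm_ge0.
Qed.

(** * Derivatives of the constraints and of the KKT map along lines *)

Section KKTcalculus.
Context {n m : nat} (f : 'cV[R]_n -> R) (g : 'cV[R]_n -> 'cV[R]_m).
Hypothesis hf : C2_lipschitz f.
Hypothesis hg : forall i : 'I_m, C2_lipschitz (component g i).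

Lemma derivable_constraint x v : derivable g x v.
Proof.
apply/derivable_mxP => i j; rewrite (ord1 j); apply: diff_derivable.
by have [] := hg i.
Qed.

Lemma jacE x i j : jac g x i j = grad (component g i) x j 0.
Proof. by rewrite !mxE derive_mx ?mxE//; exact: derivable_constraint. Qed.

Lemma jac_mulE x v i : (jac g x *m v) i 0 = edot (grad (component g i) x) v.
Proof. by rewrite mxE; apply: eq_bigr => j _; rewrite jacE. Qed.

Lemma is_derive_constraint w v t i :
  is_derive (t : R) 1 (fun s => component g i (w + s *: v))
    ((jac g (w + t *: v) *m v) i 0).
Proof.
have [dg _ _ _] := hg i; rewrite jac_mulE -derive_grad//; exact: is_derive_line.
Qed.

Lemma is_derive_grad (h : 'cV[R]_n -> R) w v t i :
  (forall x, differentiable (grad h) x) ->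
  is_derive (t : R) 1 (fun s => grad h (w + s *: v) i 0)
    ((hess h (w + t *: v) *m v) i 0).
Proof.
move=> dh; rewrite -derive_jac//.
have D := is_derive_line (dh (w + t *: v)).
have [D1 D2] := D.
apply: DeriveDef; first by move/derivable_mxP : D1 => /(_ i 0).
by rewrite -D2 (derive_mx D1) mxE.
Qed.

(** In the upper block the product rule gives the Hessian of the Lagrangian applied to [dx] plus the
    transposed Jacobian applied to [dl]; the lower block is the constraint derivative. The
    componentwise form is the one [mean_value_vector] takes. *)
Lemma is_derive_KKT w v t i :
  is_derive (t : R) 1 (fun s => KKT f g (w + s *: v) i 0)
    ((KKT' f g (w + t *: v) *m v) i 0).
Proof.
have [df ddf _ _] := hf.
rewrite /KKT' -[v in _ *m v]vsubmxK mul_block_col mul0mx addr0.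
set x := usubmx w; set dx := usubmx v; set l := dsubmx w; set dl := dsubmx v.
have xE s : usubmx (w + s *: v) = x + s *: dx by rewrite linearD linearZ.
have lE s : dsubmx (w + s *: v) = l + s *: dl by rewrite linearD linearZ.
rewrite xE lE; case: (split_ordP i) => {}i ->; rewrite ?col_mxEu ?col_mxEd.
- have -> : (fun s => KKT f g (w + s *: v) (lshift m i) 0) =
      (fun s => grad f (x + s *: dx) i 0) +
      \sum_j ((fun s => grad (component g j) (x + s *: dx) i 0) *
              (fun s => (l + s *: dl) j 0)).
    apply/funext => s; rewrite /KKT col_mxEu xE lE mxE.
    rewrite [RHS]/GRing.add /=; congr (_ + _).
    by rewrite mxE fct_sumE; apply: eq_bigr => j _; rewrite mxE jacE.
  apply: (@is_derive_eq _ _ _ _ _ _ _ ((hess f (x + t *: dx) *m dx) i 0 +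
    \sum_j (grad (component g j) (x + t *: dx) i 0 *: dl j 0 +
      (l + t *: dl) j 0 *: (hess (component g j) (x + t *: dx) *m dx) i 0))).
    apply: is_deriveD; first exact: is_derive_grad.
    apply: is_derive_sum => j; apply: is_deriveM.
      by apply: is_derive_grad => y; have [] := hg j.
    have -> : (fun s => (l + s *: dl) j 0) = cst (l j 0) + (fun s => s * dl j 0).
      by apply/funext => s; rewrite !mxE.
    rewrite -[dl j 0 in X in is_derive _ _ _ X]add0r.
    by apply: is_deriveD; exact: is_derive_mulr.
  rewrite mulmxDl -addrA [RHS]mxE; congr (_ + _); rewrite [RHS]mxE big_split /= addrC.
  rewrite mulmx_suml summxE; congr (_ + _); last first.
    rewrite [RHS]mxE; apply: eq_bigr => j _.
    by rewrite -jacE; congr (_ * _); rewrite [RHS]mxE.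
  by apply: eq_bigr => j _; rewrite -scalemxAl [RHS]mxE.
have -> : (fun s => KKT f g (w + s *: v) (rshift n i) 0) =
    (fun s => component g i (x + s *: dx)).
  by apply/funext => s; rewrite /KKT col_mxEd xE.
exact: is_derive_constraint.
Qed.

End KKTcalculus.
End Calculus.

(** * The modified Newton iteration *)

Section Newton.
Context {R : realType} {p : nat}.
Variables (H : 'cV[R]_p -> 'cV[R]_p) (B : 'M[R]_p) (z0 : 'cV[R]_p) (eta : R).
Hypotheses (Bu : B \in unitmx) (h0 : enorm (B *m H z0) <= eta).
(** [eta] bounds the first step, and radii around [z0] are measured in units of it. In the KKT
    application the factor is [s / 4], rounded up to 1/2 for [s = 3 / 2]. *)
Hypothesis contr : forall s q, (s, q) \in [:: (1, 4^-1); (3 / 2, 2^-1)] ->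
  forall z w, enorm (z - z0) <= s * eta -> enorm (w - z0) <= s * eta ->
  enorm ((z - w) - B *m (H z - H w)) <= q * enorm (z - w).

Let step z := z - B *m H z.
Let zs k := iter k step z0.
Let h (k : nat) : R := 2^-1 ^+ k.

Let hS k : h k.+1 = h k / 2.
Proof. by rewrite /h exprS mulrC. Qed.

Let h_gt0 k : 0 < h k.
Proof. by rewrite exprn_gt0// invr_gt0. Qed.

Let eta0 : 0 <= eta.
Proof. exact: le_trans (enorm_ge0 _) h0. Qed.

Let step_sub z w : step z - step w = (z - w) - B *m (H z - H w).
Proof.
rewrite /step mulmxBr; move: (B *m H z) (B *m H w) => a b.
by apply/matrixP => i j; rewrite !mxE; ring.
Qed.

Let zs1 : enorm (zs 1 - z0) <= eta.
Proof. by rewrite /zs /= /step addrAC subrr add0r enormN. Qed.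

(* The factor 1/4 at the first step keeps the iterates in the ball of radius
   3/2 eta, strictly smaller than the 2 eta allowed by the factor 1/2 alone. *)
Let newton_steps k : enorm (zs k.+2 - zs k.+1) <= h k * eta / 4 /\
  enorm (zs k.+1 - z0) <= (3 / 2 - h k / 2) * eta.
Proof.
have in32 j : enorm (zs j.+1 - z0) <= (3 / 2 - h j / 2) * eta ->
    enorm (zs j.+1 - z0) <= 3 / 2 * eta.
  move/le_trans; apply; rewrite ler_wpM2r// lerBlDr lerDl.
  by rewrite divr_ge0// ltW.
elim: k => [|k [IH1 IH2]].
  rewrite /h expr0; split; last first.
    by rewrite (le_trans zs1)//; have := eta0; lra.
  have e : enorm (z0 - z0) <= 1 * eta by rewrite subrr enorm0 mul1r.
  have z1 : enorm (zs 1 - z0) <= 1 * eta by rewrite mul1r.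
  have c := contr (mem_head _ _) z1 e.
  rewrite [zs 2]/(step (zs 1)) [X in _ - X]/(step z0) step_sub.
  by apply: le_trans c _; move: zs1; lra.
have H2 : enorm (zs k.+2 - z0) <= (3 / 2 - h k.+1 / 2) * eta.
  rewrite (le_trans (ler_enorm_dist _ (zs k.+1) _))// hS.
  by move: IH1 IH2; lra.
split=> //.
have hm : ((3 / 2, 2^-1) : R * R) \in [:: (1, 4^-1); (3 / 2, 2^-1)].
  by rewrite !inE eqxx orbT.
have c := contr hm (in32 _ H2) (in32 _ IH2).
rewrite [zs k.+3]/(step (zs k.+2)) [zs k.+2 in X in _ - X]/(step (zs k.+1)) step_sub.
by apply: le_trans c _; rewrite hS; move: IH1; lra.
Qed.

Let zs_in_ball k : enorm (zs k - z0) <= 3 / 2 * eta.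
Proof.
case: k => [|k]; first by rewrite /zs/= subrr enorm0 mulr_ge0.
have [_ /le_trans] := newton_steps k; apply; rewrite ler_wpM2r// lerBlDr lerDl.
by rewrite divr_ge0// ltW.
Qed.

Let zs_succ k : enorm (zs k.+1 - zs k) <= h k * eta.
Proof.
case: k => [|k]; first by rewrite /h expr0 mul1r.
have [] := newton_steps k; rewrite hS => /le_trans h1 _; apply: h1.
by have := mulr_ge0 (ltW (h_gt0 k)) eta0; lra.
Qed.

Let zs_cauchy k j : enorm (zs (k + j) - zs k) <= 2 * h k * eta.
Proof.
(* The telescoped form [h k - h (k + j)] of the geometric sum is what passes through the
   induction. *)
suff : enorm (zs (k + j) - zs k) <= 2 * (h k - h (k + j)) * eta.
  move/le_trans; apply; rewrite ler_wpM2r// ler_wpM2l// gerBl ltW//.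
elim: j => [|j IH]; first by rewrite addn0 !subrr enorm0 mulr0 mul0r.
rewrite addnS (le_trans (ler_enorm_dist _ (zs (k + j)) _))//.
by have := zs_succ (k + j); move: IH; rewrite hS; lra.
Qed.

Let h_small e : 0 < e -> exists k, h k * eta < e.
Proof.
move=> e0; have : 0 < e / (eta + 1) by rewrite divr_gt0// ltr_wpDl.
have /cvgr0Pnorm_lt/[apply] : h @ \oo --> (0 : R).
  by apply: cvg_expr; rewrite ger0_norm ?invr_ge0// invf_lt1 ?ltr1n.
move=> [k _ /(_ k (leqnn k))] /=.
rewrite gtr0_norm// ltr_pdivlMr ?ltr_wpDl// => hk; exists k.
by apply: le_lt_trans hk; rewrite ler_wpM2l ?(ltW (h_gt0 _))// lerDl.
Qed.

Lemma newton_converges : exists zstar, [/\ H zstar = 0,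
  enorm (zstar - z0) <= 3 / 2 * eta &
  forall k, enorm (zs k - zstar) <= 2 * h k * eta].
Proof.
have : cauchy (zs @ \oo).
  apply: cauchy_exP => e e0; have [k hk] := h_small (divr_gt0 e0 (ltr0n _ 2)).
  exists (zs k); exists k => // j /= kj; rewrite -ball_normE /=.
  rewrite (le_lt_trans (normr_le_enorm _))// enormB -(subnKC kj).
  by rewrite (le_lt_trans (zs_cauchy _ _))//; lra.
move=> /cauchy_cvgP/cvg_ex[zstar zc].
have zlim e N : 0 < e -> exists2 k, (N <= k)%N & enorm (zs k - zstar) < e.
  move=> e0; have /zc [M _ hM] := enorm_near zstar e0.
  by exists (maxn N M); [exact: leq_maxl|apply: hM; exact: leq_maxr].
have conv k : enorm (zs k - zstar) <= 2 * h k * eta.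
  apply/ler_addgt0Pr => e e0; have [j kj hj] := zlim e k e0.
  rewrite (le_trans (ler_enorm_dist _ (zs j) _))// lerD ?(ltW hj)//.
  by rewrite enormB -(subnKC kj).
have inb : enorm (zstar - z0) <= 3 / 2 * eta.
  apply/ler_addgt0Pr => e e0; have [j _ hj] := zlim e 0%N e0.
  rewrite (le_trans (ler_enorm_dist _ (zs j) _))// addrC lerD ?zs_in_ball//.
  by rewrite enormB ltW.
exists zstar; split=> //.
(* The residual at the limit splits into a contraction defect, the distance of [zs k] from the limit
   and one step, all of order [h k * eta]. *)
suff /eqP : enorm (B *m H zstar) == 0.
  by move/enorm_eq0 => BH; rewrite -(mulKmx Bu (H zstar)) BH mulmx0.
rewrite eq_le enorm_ge0 andbT; apply/ler_addgt0Pr => e e0; rewrite add0r.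
(* The three terms add up to at most [4 * h k * eta], hence the fraction 1/5. *)
have [k hk] := h_small (divr_gt0 e0 (ltr0n _ 5)).
have hm : ((3 / 2, 2^-1) : R * R) \in [:: (1, 4^-1); (3 / 2, 2^-1)].
  by rewrite !inE eqxx orbT.
have c := contr hm (zs_in_ball k) inb.
have -> : B *m H zstar = ((zs k - zstar) - B *m (H (zs k) - H zstar))
    - (zs k - zstar) + (zs k - zs k.+1).
  rewrite [zs k.+1]/(step (zs k)) /step mulmxBr.
  move: (B *m H (zs k)) (B *m H zstar) => a b.
  by apply/matrixP => i j; rewrite !mxE; ring.
have := ler_enormD ((zs k - zstar) - B *m (H (zs k) - H zstar)
    - (zs k - zstar)) (zs k - zs k.+1).
have := ler_enormD ((zs k - zstar) - B *m (H (zs k) - H zstar)) (- (zs k - zstar)).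
rewrite enormN (enormB (zs k) (zs k.+1)).
have := zs_succ k; have := conv k; move: hk c; lra.
Qed.

End Newton.

(** * First-order condition at a nearest point *)

Section FirstOrder.
Context {R : realType} {n m : nat}.
Variables (f : 'cV[R]_n -> R) (g : 'cV[R]_n -> 'cV[R]_m).

(** * The orthogonal projector onto the tangent space *)

Section Projector.
Variable x : 'cV[R]_n.
Hypothesis rk : \rank (jac g x) = m.
Let A := jac g x.
Let M := A *m A^T.

(** The product of [v] with [M *m v] is the squared norm of [A^T *m v], and [A^T] is injective
    because [A] has full row rank. *)
Lemma gram_unit : M \in unitmx.
Proof.
apply: unitmx_inj => v Mv0.
have : enorm (A^T *m v) ^+ 2 = 0.
  by rewrite enorm_sqr edot_mulmx trmxK mulmxA Mv0 edotC edot0l.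
move/eqP; rewrite sqrf_eq0 => /eqP/enorm_eq0 Av0.
have fA : row_free A by rewrite /row_free rk.
apply: trmx_inj; rewrite trmx0; apply: (row_free_inj fA).
by rewrite mul0mx -[A]trmxK -trmx_mul Av0 trmx0.
Qed.

Lemma jac_proj_tangent : A *m proj_tangent g x = 0.
Proof.
rewrite /proj_tangent -/A -/M mulmxBr mulmx1 !mulmxA -/M.
by rewrite mulmxV ?gram_unit// mul1mx subrr.
Qed.

Lemma proj_tangent_jacT : proj_tangent g x *m A^T = 0.
Proof.
rewrite /proj_tangent -/A -/M mulmxBl mul1mx -!mulmxA -/M.
by rewrite mulVmx ?gram_unit// mulmx1 subrr.
Qed.

Lemma proj_tangent_sym : (proj_tangent g x)^T = proj_tangent g x.
Proof.
rewrite /proj_tangent -/A linearB /= trmx1 !trmx_mul trmxK trmx_inv.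
by rewrite trmx_mul trmxK mulmxA.
Qed.

(** The projector is symmetric, and idempotent because it kills the range of [A^T]. *)
Lemma edot_proj_tangent v :
  edot v (proj_tangent g x *m v) = enorm (proj_tangent g x *m v) ^+ 2.
Proof.
rewrite enorm_sqr [RHS]edot_mulmx proj_tangent_sym mulmxA.
congr (edot v (_ *m v)); rewrite {3}/proj_tangent mulmxBr mulmx1 !mulmxA.
by rewrite proj_tangent_jacT !mul0mx subr0.
Qed.

Lemma enorm_proj_tangent v : enorm (proj_tangent g x *m v) <= enorm v.
Proof.
have [->|P0] := eqVneq (enorm (proj_tangent g x *m v)) 0; first exact: enorm_ge0.
have := cauchy_schwarz v (proj_tangent g x *m v).
by rewrite edot_proj_tangent expr2 ler_pM2r// lt0r P0 enorm_ge0.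
Qed.

(** The least-squares multiplier leaves the projected gradient as residual of the Lagrangian
    gradient; this makes the Phase 1 switching quantity the initial residual of Phase 2. *)
Lemma proj_tangent_multiplier :
  proj_tangent g x *m grad f x = grad f x + A^T *m multiplier f g x.
Proof.
by rewrite /multiplier /proj_tangent -/A mulmxBl mul1mx mulmxN !mulmxA.
Qed.

End Projector.

Hypothesis hg : forall i : 'I_m, C2_lipschitz (component g i).

(** The finitely many constraint gradients are continuous, so one neighbourhood serves all rows; the
    divisor [m.+1] pays for passing from the max norm to the Euclidean norm. *)
Lemma jac_near x tau : 0 < tau -> exists2 e : R, 0 < e & forall y v,
  enorm (y - x) < e -> enorm ((jac g y - jac g x) *m v) <= tau * enorm v.
Proof.
move=> tau0; have m1 : 0 < (m.+1)%:R :> R by rewrite ltr0n.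
have : \forall y \near x, forall i : 'I_m,
    enorm (grad (component g i) y - grad (component g i) x) < tau / m.+1%:R.
  apply: (@filter_forall _ _ _ _ (nbhs_filter x)) => i; have [_ dg _ _] := hg i.
  have /differentiable_continuous cg := dg x.
  apply: (cg (fun y => enorm (y - grad (component g i) x) < tau / m.+1%:R)).
  by apply: enorm_near; rewrite divr_gt0.
move=> /near_enorm[e e0 he]; exists e => // y v /he hy.
apply: le_trans (enorm_le_normr _) _.
have : `|(jac g y - jac g x) *m v| <= tau / m.+1%:R * enorm v.
  rewrite [leLHS]/Num.Def.normr/= mx_normrE; apply: bigmax_le => [|[i j] _] /=.
    by rewrite mulr_ge0 ?enorm_ge0// divr_ge0// ltW.
  rewrite (ord1 j) mulmxBl mxE [X in _ + X]mxE !(jac_mulE hg) -edotNl -edotDl.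
  apply: le_trans (ler_norm_edot _ _) _; rewrite ler_wpM2r ?enorm_ge0//.
  exact: ltW.
move=> h; apply: le_trans (ler_wpM2l _ h) _; rewrite ?ler0n// mulrA.
rewrite ler_wpM2r ?enorm_ge0// mulrCA -[leRHS]mulr1 ler_wpM2l ?(ltW tau0)//.
by rewrite ler_pdivrMr// mul1r ler_nat.
Qed.

(* A tangent direction v is followed up to o(t): the simplified Newton method
   solves g (x + t v + A^T u) = 0 for u, starting from u = 0. *)
Lemma feasible_along_tangent x v eps : feasible g x -> \rank (jac g x) = m ->
  jac g x *m v = 0 -> 0 < eps -> exists2 e : R, 0 < e & forall t, 0 < t < e ->
  exists2 w, enorm w <= eps * t & feasible g (x + t *: v + w).
Proof.
move=> gx rk Av eps0; set A := jac g x in rk Av *.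
have Mu := gram_unit rk; rewrite -/A in Mu; set M := A *m A^T in Mu.
pose B := invmx M.
have [b b0 hb] := enorm_mulmx_bounded B.
have [a a0 ha] := enorm_mulmx_bounded A^T.
(* [eta1 * t] will bound the first Newton step in [u]; the solution then has norm at most
   [3 / 2 * eta1 * t], and applying [A^T] keeps it below [eps * t]. *)
pose eta1 := eps / (2 * (a + 1)).
have a1 : 0 < a + 1 by rewrite ltr_wpDl.
have b1 : 0 < b + 1 by rewrite ltr_wpDl.
have v1 : 0 < enorm v + 1 by rewrite ltr_wpDl// enorm_ge0.
have eta10 : 0 < eta1 by rewrite divr_gt0// mulr_gt0.
(* The first entry controls the initial residual, of size [tau * enorm v * t]; the second gives the
   contraction factor 1/4. *)
pose tau := Num.min (eta1 / ((b + 1) * (enorm v + 1)))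
                    (4^-1 / ((a + 1) * (b + 1))).
have tau0 : 0 < tau by rewrite lt_min !divr_gt0// ?invr_gt0// mulr_gt0.
have tau1 : b * (tau * enorm v) <= eta1.
  have : tau <= eta1 / ((b + 1) * (enorm v + 1)) by rewrite ge_min lexx.
  rewrite ler_pdivlMr ?mulr_gt0//; apply: le_trans.
  rewrite mulrCA ler_wpM2l ?(ltW tau0)// ler_pM ?enorm_ge0 ?lerDl//.
have tau2 : b * (tau * a) <= 4^-1.
  have : tau <= 4^-1 / ((a + 1) * (b + 1)) by rewrite ge_min lexx orbT.
  rewrite ler_pdivlMr ?mulr_gt0//; apply: le_trans.
  by rewrite mulrCA ler_wpM2l ?(ltW tau0)// mulrC ler_pM ?enorm_ge0 ?lerDl.
have [e e0 he] := jac_near x tau0.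
(* Every point visited lies within [t * (c - 1)] of [x]; the added 1 makes [c] positive. *)
pose c := enorm v + a * (3 / 2 * eta1) + 1.
have c0 : 0 < c.
  by have := mulr_ge0 a0 (ltW eta10); have := enorm_ge0 v; rewrite /c; lra.
exists (e / c); first by rewrite divr_gt0.
move=> t /andP[t0 tec]; have tc : t * c < e by rewrite -ltr_pdivlMr.
have gB p q rho : enorm (p - x) <= rho -> enorm (q - x) <= rho -> rho < e ->
    enorm (g p - g q - A *m (p - q)) <= tau * enorm (p - q).
  move=> pr qr re; apply: (mean_value_vector (J := jac g) (z0 := x) (rho := rho)) => //.
    move=> s i; exact: is_derive_constraint.
  by move=> y yr; apply: he; exact: le_lt_trans re.
pose H u := g (x + t *: v + A^T *m u).
have Hx u : enorm u <= 3 / 2 * (eta1 * t) ->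
    enorm (x + t *: v + A^T *m u - x) <= t * (c - 1).
  move=> hu; rewrite addrAC addrC [_ - x]addrAC subrr add0r.
  rewrite (le_trans (ler_enormD _ _))// enormZ gtr0_norm//.
  have := le_trans (ha u) (ler_wpM2l a0 hu); rewrite /c; lra.
have tce : t * (c - 1) < e.
  by apply: le_lt_trans tc; rewrite ler_wpM2l ?gerBl ?(ltW t0).
have et0 : 0 <= eta1 * t by rewrite mulr_ge0 ?(ltW eta10) ?(ltW t0).
have h0 : enorm (B *m H 0) <= eta1 * t.
  have xt : enorm (x + t *: v - x) <= t * (c - 1).
    by have := Hx 0; rewrite mulmx0 addr0; apply; rewrite enorm0; lra.
  have xx : enorm (x - x) <= t * (c - 1).
    by rewrite subrr enorm0 (le_trans _ xt)// enorm_ge0.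
  have := gB _ _ _ xt xx tce.
  have gx0 : g x = 0 := gx.
  rewrite /H mulmx0 addr0 gx0 subr0 [x + _]addrC addrK -scalemxAr Av scaler0 subr0.
  rewrite enormZ gtr0_norm// => h1.
  apply: le_trans (hb _) _; apply: le_trans (ler_wpM2l b0 h1) _.
  by have := ler_wpM2r (ltW t0) tau1; lra.
(* In [u] the map [H] has approximate derivative [M], inverted by [B]; the one factor 1/4 serves
   both radii required by the Newton lemma. *)
have contr z w rho : rho <= 3 / 2 * (eta1 * t) ->
    enorm (z - 0) <= rho -> enorm (w - 0) <= rho ->
    enorm ((z - w) - B *m (H z - H w)) <= 4^-1 * enorm (z - w).
  rewrite !subr0 => hr zr wr.
  have := gB _ _ _ (Hx _ (le_trans zr hr)) (Hx _ (le_trans wr hr)) tce.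
  rewrite -/(H z) -/(H w) opprD addrACA subrr add0r -mulmxBr mulmxA -/M => h1.
  have -> : z - w - B *m (H z - H w) = - (B *m (H z - H w - M *m (z - w))).
    by rewrite [in RHS]mulmxBr /B mulKmx// opprB.
  rewrite enormN; apply: le_trans (hb _) _.
  apply: le_trans (ler_wpM2l b0 (le_trans h1 (ler_wpM2l (ltW tau0) (ha _)))) _.
  by rewrite !mulrA -(mulrA b) ler_wpM2r ?enorm_ge0// -mulrA.
have Bu : B \in unitmx by rewrite unitmx_inv.
have [|u [Hu + _]] := newton_converges Bu h0.
  move=> s q; rewrite !inE => /orP[]/eqP[-> ->] z w zr wr.
    by apply: (contr z w _ _ zr wr); lra.
  by have := contr z w _ (lexx _) zr wr; have := enorm_ge0 (z - w); lra.
rewrite subr0 => hu; exists (A^T *m u) => //.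
apply: le_trans (ha u) _.
have := ler_wpM2l a0 hu => h1; apply: le_trans h1 _.
have E : eta1 * (2 * (a + 1)) = eps by rewrite /eta1 divfK// gt_eqF// mulr_gt0.
rewrite -E; have := mulr_ge0 a0 et0; lra.
Qed.

(** Moving from [x] along a tangent direction with an o(t) correction stays feasible and cannot come
    closer to [y]; expanding the squared distance and dividing by [t] gives a sign condition for
    every tangent vector. *)
Lemma nearest_first_order x y : \rank (jac g x) = m ->
  nearest (feasible g) y x -> proj_tangent g x *m (x - y) = 0.
Proof.
move=> rk [gx ny]; move qE : (x - y) => q.
have key v : jac g x *m v = 0 -> 0 <= edot q v.
  move=> Av; apply/ler_addgt0Pr => e e0.
  have q1 : 0 < enorm q + 1 by rewrite ltr_wpDl// enorm_ge0.
  have [d d0 hd] := feasible_along_tangent gx rk Av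
    (divr_gt0 e0 (mulr_gt0 (ltr0n _ 4) q1)).
  set eps := e / _ in hd.
  have eps0 : 0 < eps by rewrite divr_gt0// mulr_gt0.
  have epsq : eps * (4 * (enorm q + 1)) = e.
    by rewrite /eps divfK// gt_eqF// mulr_gt0.
  (* [t <= e / c] makes the second-order term at most [t * e], while the choice of [eps] makes the
     correction term [edot q w] at most [t * e / 4]. *)
  set c := (enorm v + eps) ^+ 2 + 1.
  have c0 : 0 < c by rewrite ltr_wpDl// sqr_ge0.
  set t := Num.min (d / 2) (e / c).
  have t0 : 0 < t by rewrite lt_min !divr_gt0.
  have td : t < d by rewrite gt_min; apply/orP; left; lra.
  have tc : t * c <= e by rewrite -ler_pdivlMr// ge_min lexx orbT.
  have [|w hw gw] := hd t; first by rewrite t0.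
  have := le_trans (_ : enorm (y - x) <= _) (lexx (enorm (y - (x + t *: v + w)))).
  rewrite ny => /(_ (dist_le y gw)); rewrite -ny.
  have -> : y - (x + t *: v + w) = - (q + (t *: v + w)).
    by rewrite -qE; apply/matrixP => i j; rewrite !mxE; ring.
  rewrite enormN enormB qE -ler_sqr ?nnegrE ?enorm_ge0//.
  rewrite enormD_sqr edotDr edotZr => h1.
  have h2 : enorm (t *: v + w) ^+ 2 <= t * (t * c).
    have : enorm (t *: v + w) <= t * (enorm v + eps).
      by rewrite (le_trans (ler_enormD _ _))// enormZ gtr0_norm//; lra.
    rewrite -ler_sqr ?nnegrE ?enorm_ge0 ?mulr_ge0 ?addr_ge0 ?enorm_ge0
      ?(ltW t0) ?(ltW eps0)//.
    by move/le_trans; apply; rewrite exprMn mulrA -expr2 ler_wpM2l ?sqr_ge0// lerDl.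
  have h3 : edot q w <= t * (e / 4).
    apply: le_trans (cauchy_schwarz _ _) _.
    apply: le_trans (ler_wpM2l (enorm_ge0 q) hw) _.
    by rewrite -epsq; have := mulr_ge0 (ltW eps0) (ltW t0); lra.
  have h4 := ler_wpM2l (ltW t0) tc.
  by rewrite -(ler_pM2l t0); have := mulr_gt0 t0 e0; lra.
(* For this tangent vector the sign condition reads that minus the squared norm of the projection of
   [q] is nonnegative. *)
set v := - (proj_tangent g x *m q).
have := key v; rewrite mulmxN mulmxA jac_proj_tangent// mul0mx oppr0 => /(_ erefl).
rewrite /v edotNr edot_proj_tangent// oppr_ge0 real_exprn_even_le0 ?num_real//=.
by move=> /eqP/enorm_eq0.
Qed.

End FirstOrder.

(** * The two phases *)

Lemma le_natceil (R : realType) (t : R) : (0 < natceil t)%N /\ t <= (natceil t)%:R.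
Proof. by rewrite /natceil; case: ex_minnP => N /andP[]. Qed.

Lemma log2_le_natceil (R : realType) (t : R) : 0 < t -> t <= 2 ^+ natceil (log2 t).
Proof.
move=> t0; have [_] := le_natceil (log2 t).
have l2 : 0 < ln (2 : R) by rewrite ln_gt0// ltr1n.
rewrite /log2 ler_pdivrMr// mulr_natl -lnXn// ler_ln ?posrE// exprn_gt0//.
Qed.

(** The Newton error carries a leading factor 2, which costs one step beyond the logarithm: the
    [+ 1] in [N2]. *)
Lemma halving_bound (R : realType) (T : R) (N j : nat) :
  (N < j)%N -> 0 <= T -> T <= 2 ^+ N -> 2 * 2^-1 ^+ j * T <= 1.
Proof.
case: j => // j; rewrite ltnS => Nj T0 TN.
rewrite exprS mulrA divff ?pnatr_eq0// mul1r.
have h : 2^-1 ^+ j <= 2^-1 ^+ N :> R.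
  by apply: ler_wiXn2l; rewrite ?invr_ge0// invf_le1// ler1n.
apply: le_trans (ler_wpM2r T0 h) _.
by rewrite exprVn mulrC ler_pdivrMr ?exprn_gt0// mul1r.
Qed.

Lemma enorm_col_mx (R : realType) n m (u : 'cV[R]_n) (v : 'cV[R]_m) :
  enorm (col_mx u v) ^+ 2 = enorm u ^+ 2 + enorm v ^+ 2.
Proof.
rewrite !enorm_sqr /edot big_split_ord /=; congr (_ + _);
  by apply: eq_bigr => i _; rewrite ?col_mxEu ?col_mxEd.
Qed.

Lemma enorm_usubmx (R : realType) n m (z : 'cV[R]_(n + m)) :
  enorm (usubmx z) <= enorm z.
Proof.
rewrite -ler_sqr ?nnegrE ?enorm_ge0// -{2}(vsubmxK z) enorm_col_mx lerDl.
exact: sqr_ge0.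
Qed.

(** A positive [N] keeps the telescoped inequality strict, so a contradiction arises even if the
    admissible total decrease is exactly [N%:R * c]. *)
Lemma linear_decrease (R : realType) (a : nat -> R) (c : R) (N : nat) :
  (forall k, (k < N)%N -> a k.+1 + c < a k) -> (0 < N)%N -> a N + N%:R * c < a 0.
Proof.
case: N => // N; elim: N => [|N IH] h _; first by rewrite mul1r; exact: h.
have IHN : a N.+1 + N.+1%:R * c < a 0 by apply: IH => // k kN; apply: h; exact: ltnW.
by have := h N.+1 (ltnSn _); rewrite -[N.+2%:R]natr1; lra.
Qed.

(** * Phase 1: gradient projection *)

Section GradientProjection.
Context {R : realType} {n m : nat}.
Variables (f : 'cV[R]_n -> R) (g : 'cV[R]_n -> 'cV[R]_m) (L0 L1 rad gamma : R).
Hypotheses (hf : C2_lipschitz f)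
  (hg : forall i : 'I_m, C2_lipschitz (component g i)).
Hypotheses (hL0 : 0 < L0)
  (hfL0 : forall x y : 'cV[R]_n, `|f x - f y| <= L0 * enorm (x - y)).
Hypotheses (hL1 : 0 < L1) (hfL1 : lipschitz_wrt enorm enorm setT L1 (grad f)).
Hypothesis hScompact : compact (feasible g).
Hypothesis hSrank : forall x, feasible g x -> \rank (jac g x) = m.
Hypothesis hSprox : proximally_smooth (feasible g) rad.
Hypothesis hgamma : 0 < gamma < Num.min (1 / L1) (rad / L0).

Let gamma0 : 0 < gamma.
Proof. by case/andP: hgamma. Qed.

Let gammaL1 : 0 < 1 - gamma * L1.
Proof.
case/andP: hgamma => _; rewrite lt_min => /andP[+ _].
by rewrite ltr_pdivlMr// subr_gt0.
Qed.

Let gammaL1' : 0 < 1 + gamma * L1.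
Proof. by rewrite addr_gt0// mulr_gt0. Qed.

Let df x : differentiable f x.
Proof. by have [] := hf. Qed.

(** The derivative of [f] along its own gradient is the squared gradient norm, and the Lipschitz
    bound limits it. *)
Lemma enorm_grad_le x : enorm (grad f x) <= L0.
Proof.
have : 'D_(grad f x) f x <= L0 * enorm (grad f x).
  apply: (derive_le ltr01); first exact: diff_derivable.
  move=> t /andP[t0 _]; rewrite -lerBlDl; apply: le_trans (ler_norm _) _.
  apply: le_trans (hfL0 _ _) _.
  by rewrite [x + _]addrC addrK enormZ gtr0_norm// mulrCA.
have [->|G0] := eqVneq (enorm (grad f x)) 0; first by move=> _; exact: ltW.
by rewrite derive_grad// -enorm_sqr expr2 ler_pM2r// lt0r G0 enorm_ge0.
Qed.

Let step x := metric_proj (feasible g) (x - gamma *: grad f x).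

(** Since [gamma * L0 < rad], the trial point stays in the tube around the feasible set where the
    projection is unique. *)
Lemma nearest_step x : feasible g x ->
  nearest (feasible g) (x - gamma *: grad f x) = [set step x].
Proof.
move=> gx; apply: (nearest_metric_proj hScompact _ hSprox); first by exists x.
apply: le_lt_trans (dist_le _ gx) _.
rewrite addrAC subrr add0r enormN enormZ gtr0_norm//.
case/andP: hgamma => _; rewrite lt_min => /andP[_].
rewrite ltr_pdivlMr//; apply: le_lt_trans.
by rewrite ler_wpM2l ?enorm_grad_le// ltW.
Qed.

Let step_near x : feasible g x ->
  nearest (feasible g) (x - gamma *: grad f x) (step x).
Proof. by move=> /nearest_step ->. Qed.

Lemma feasible_step x : feasible g x -> feasible g (step x).
Proof. by case/step_near. Qed.

(** The feasible point [x] is no closer to the trial point than its projection is; expanding squares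
    bounds the product of gradient and step by minus the squared step over [2 * gamma], which enters
    the descent inequality. *)
Lemma step_descent x : feasible g x ->
  f (step x) + (1 - gamma * L1) / (2 * gamma) * enorm (step x - x) ^+ 2 <= f x.
Proof.
move=> gx; have [_ ny] := step_near gx.
move sE : (step x - x) => s; have xsE : step x = x + s by rewrite -sE addrC subrK.
have := dist_le (x - gamma *: grad f x) gx; rewrite -ny xsE.
have -> : x - gamma *: grad f x - (x + s) = - (s + gamma *: grad f x).
  by apply/matrixP => i j; rewrite !mxE; ring.
rewrite addrAC subrr add0r !enormN -ler_sqr ?nnegrE ?enorm_ge0//.
rewrite enormD_sqr edotZr (edotC s) => h.
have := descent x s df hfL1 => h1; apply: le_trans (lerD h1 (lexx _)) _.
have h2 : edot (grad f x) s <= - (enorm s ^+ 2 / (2 * gamma)).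
  rewrite -(ler_pM2l (mulr_gt0 (ltr0n _ 2) gamma0)).
  rewrite mulrN [2 * gamma * (_ / _)]mulrC divfK ?gt_eqF ?mulr_gt0//; lra.
have -> : (1 - gamma * L1) / (2 * gamma) * enorm s ^+ 2 =
    enorm s ^+ 2 / (2 * gamma) - L1 / 2 * enorm s ^+ 2.
  by field; rewrite gt_eqF.
by lra.
Qed.

(** The first-order condition at the new point replaces the projected old gradient by the projected
    step over [- gamma]; the change of gradient adds [L1] to the constant [1 / gamma]. *)
Lemma step_stationarity x : feasible g x ->
  enorm (proj_tangent g (step x) *m grad f (step x)) <=
  (1 + gamma * L1) / gamma * enorm (step x - x).
Proof.
move=> gx; have gsx := feasible_step gx; have rk := hSrank gsx.
have P0 := nearest_first_order hg rk (step_near gx).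
set P := proj_tangent g (step x) in P0 *.
have -> : P *m grad f (step x) = P *m (grad f (step x) - grad f x)
    - gamma^-1 *: (P *m (step x - x)).
  have E : step x - (x - gamma *: grad f x) = (step x - x) + gamma *: grad f x.
    by apply/matrixP => i j; rewrite !mxE; ring.
  move: P0; rewrite E mulmxDr -scalemxAr => /eqP; rewrite addr_eq0 => /eqP ->.
  by rewrite scalerN opprK scalerA mulVf ?gt_eqF// scale1r mulmxBr subrK.
apply: le_trans (ler_enormD _ _) _; rewrite enormN enormZ gtr0_norm ?invr_gt0//.
have h1 := le_trans (enorm_proj_tangent rk _)
  (hfL1 (x := step x) (y := x) Logic.I Logic.I).
have h2 := enorm_proj_tangent rk (step x - x).
have -> : (1 + gamma * L1) / gamma * enorm (step x - x) =
    L1 * enorm (step x - x) + gamma^-1 * enorm (step x - x).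
  by field; rewrite gt_eqF.
by apply: lerD => //; rewrite ler_wpM2l// invr_ge0 ltW.
Qed.

(** Allows a nearest stationary point to be chosen. The error bound alone cannot supply one, the
    distance to the empty set being 0 by default. *)
Lemma stationary_exists : feasible g !=set0 -> stationary f g !=set0.
Proof.
move=> S0.
have cf : {within feasible g, continuous f}.
  by apply: continuous_subspaceT; exact: (lipschitz_continuous_enorm hfL0).
have [x /set_mem gx hx] := compact_EVT_min S0 hScompact cf.
have s0 : enorm (step x - x) = 0.
  apply/eqP; have := step_descent gx.
  have := hx _ (mem_set (feasible_step gx)) => h1 h2.
  have : (1 - gamma * L1) / (2 * gamma) * enorm (step x - x) ^+ 2 <= 0 by lra.
  rewrite pmulr_rle0 ?divr_gt0 ?mulr_gt0//.
  by rewrite real_exprn_even_le0 ?num_real.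
exists x; split=> //; apply: enorm_eq0; apply/eqP.
have := step_stationarity gx; rewrite s0 mulr0.
move/enorm_eq0/eqP : s0; rewrite subr_eq0 => /eqP ->.
by rewrite eq_le enorm_ge0 andbT.
Qed.

Variable x0 : 'cV[R]_n.
Hypothesis hx0 : feasible g x0.
Let x := grad_proj_seq f g gamma x0.

Lemma feasible_grad_proj_seq k : feasible g (x k).
Proof. by elim: k => [|k IH]//; exact: feasible_step. Qed.

Variable C : R.
Hypothesis C0 : 0 < C.
Let Df := f x0 - inf [set f y | y in feasible g].
Let N1 := natceil (2 * Df * (1 + gamma * L1) ^+ 2
                       / (C ^+ 2 * gamma * (1 - gamma * L1))).

(** If the first [N1] steps were all longer, [f] would fall below its infimum on the feasible
    set. *)
Lemma short_step_exists : exists2 k, (k < N1)%N &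
  enorm (x k.+1 - x k) <= gamma / (1 + gamma * L1) * C.
Proof.
apply: contrapT => nex.
set theta := gamma / (1 + gamma * L1) * C in nex.
have theta0 : 0 < theta by rewrite mulr_gt0// divr_gt0.
pose c := (1 - gamma * L1) / (2 * gamma).
have c0 : 0 < c by rewrite divr_gt0// mulr_gt0.
have [N1_gt0 N1_ge] := le_natceil (2 * Df * (1 + gamma * L1) ^+ 2
                       / (C ^+ 2 * gamma * (1 - gamma * L1))).
rewrite -/N1 in N1_gt0 N1_ge.
have big k : (k < N1)%N -> f (x k.+1) + c * theta ^+ 2 < f (x k).
  move=> kN; apply: lt_le_trans (step_descent (feasible_grad_proj_seq k)).
  rewrite ltrD2l -/c ltr_pM2l// ltr_pXn2r ?nnegrE ?enorm_ge0 ?ltW//.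
  by rewrite ltNge; apply/negP => h; apply: nex; exists k.
have := @linear_decrease R (fun k => f (x k)) _ N1 big N1_gt0.
have lbS : has_lbound [set f y | y in feasible g].
  have cf : {within feasible g, continuous f}.
    by apply: continuous_subspaceT; exact: (lipschitz_continuous_enorm hfL0).
  have [y _ hy] := compact_EVT_min (ex_intro _ x0 hx0) hScompact cf.
  by exists (f y) => _ [w gw <-]; apply: hy; exact: mem_set.
have := ge_inf lbS (imageP f (feasible_grad_proj_seq N1)).
(* The argument of the ceiling in [N1] is exactly [Df / (c * theta ^+ 2)]. *)
have : Df <= N1%:R * (c * theta ^+ 2).
  have ct0 : 0 < c * theta ^+ 2 by rewrite mulr_gt0// exprn_gt0.
  rewrite -ler_pdivrMr//; apply: le_trans N1_ge; rewrite le_eqVlt; apply/orP; left.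
  by apply/eqP; rewrite /c /theta; field; rewrite !gt_eqF.
rewrite /Df; lra.
Qed.

(** A short step into [k.+1] triggers both conditions there, so the first switching index is at most
    [N1]; under either condition the projected gradient at that index is at most [C]. *)
Lemma phase1 (switch : nat -> Prop) :
  switch = switch_grad f g C x \/ switch = switch_step gamma L1 C x ->
  exists K, [/\ (K <= N1)%N, switch K, forall k, (k < K)%N -> ~ switch k &
    enorm (proj_tangent g (x K) *m grad f (x K)) <= C].
Proof.
move=> hs; have [k kN hk] := short_step_exists.
have gk := step_stationarity (feasible_grad_proj_seq _).
have short j : enorm (x j.+1 - x j) <= gamma / (1 + gamma * L1) * C ->
    switch_grad f g C x j.+1.
  move=> hj; apply: le_trans (gk j) _.
  rewrite -ler_pdivlMl ?divr_gt0// invf_div; exact: hj.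
have sw : switch k.+1.
  by case: hs => ->; [exact: short|split].
have ex : exists k, `[< switch k >] by exists k.+1; apply/asboolP.
case: (ex_minnP ex) => K /asboolP sK minK; exists K; split=> //.
- by apply: leq_trans kN; apply: minK; apply/asboolP.
- by move=> j jK /asboolP /minK; rewrite leqNgt jK.
(* The step condition includes [1 <= K], so [K.-1] is a true predecessor. *)
case: hs sK => -> //= [K1 hK]; have := short K.-1.
by rewrite prednK//; apply.
Qed.

End GradientProjection.

(** * Phase 2: modified Newton method *)

Section ModifiedNewton.
Context {R : realType} {n m : nat}.
Variables (f : 'cV[R]_n -> R) (g : 'cV[R]_n -> 'cV[R]_m).
Hypotheses (hf : C2_lipschitz f)
  (hg : forall i : 'I_m, C2_lipschitz (component g i)).
Hypothesis hSrank : forall x, feasible g x -> \rank (jac g x) = m.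

Lemma KKT_lift x : feasible g x ->
  enorm (KKT f g (lift_multiplier f g x)) = enorm (proj_tangent g x *m grad f x).
Proof.
move=> gx; apply/eqP; rewrite -(@eqrXn2 _ 2) ?enorm_ge0//.
rewrite /KKT /lift_multiplier col_mxKu col_mxKd -proj_tangent_multiplier.
have -> : g x = 0 by [].
by rewrite enorm_col_mx enorm0 expr0n addr0.
Qed.

(** The projector kills the range of the transposed Jacobian, whatever the multiplier part of [z]
    is. *)
Lemma stationary_KKT z : KKT f g z = 0 -> stationary f g (usubmx z).
Proof.
rewrite /KKT -[0]vsubmxK linear0 [dsubmx 0]linear0 => /eq_col_mx[F1 F2].
split=> //; have := congr1 (mulmx (proj_tangent g (usubmx z))) F1.
by rewrite mulmxDr mulmx0 mulmxA proj_tangent_jacT ?mul0mx ?addr0//; exact: hSrank.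
Qed.

Lemma phase2 (z0 zs : 'cV[R]_(n + m)) (Sigma : set 'cV[R]_(n + m))
    (sigma0 beta r C L : R) :
  Sigma zs -> enorm (z0 - zs) <= r -> 0 < r ->
  0 < sigma0 -> 0 <= beta < 1 -> 0 < L -> 0 <= C ->
  KKT' f g zs \in unitmx -> opnorm (invmx (KKT' f g zs)) <= sigma0 ->
  opnorm (KKT' f g z0 - KKT' f g zs) <= beta / sigma0 ->
  lipschitz_wrt enorm opnorm [set z | dist Sigma z < 2 * r] L (KKT' f g) ->
  (1 - beta) / (2 * sigma0 * L) <= r ->
  enorm (KKT f g z0) <= C -> C <= (1 - beta) ^+ 2 / (4 * L * sigma0 ^+ 2) ->
  KKT' f g z0 \in unitmx /\ exists2 zstar, KKT f g zstar = 0 &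
    forall k, enorm (newton_seq f g z0 k - zstar) <=
      2 * 2^-1 ^+ k * (sigma0 / (1 - beta) * C).
Proof.
move=> Szs z0zs r0 s0 /andP[b0 b1] hL C0 uzs izs dz hF hr hC hC2.
have [uz0 hB] := unitmx_perturb uzs s0 (introT andP (conj b0 b1)) izs dz.
split=> //; set A := KKT' f g z0 in uz0 hB *; set B := invmx A in hB.
have b1' : 0 < 1 - beta by rewrite subr_gt0.
set sigma := sigma0 / (1 - beta) in hB *.
have sigma_gt0 : 0 < sigma by rewrite divr_gt0.
set eta := sigma * C.
have eta0 : 0 <= eta by rewrite mulr_ge0// ltW.
(* The second entry of the minimum defining the threshold is [1 / (4 * L * sigma ^+ 2)]: a
   Newton-Kantorovich smallness condition. *)
have hs : sigma * L * eta <= 4^-1.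
  have : sigma * L * sigma * C <=
      sigma * L * sigma * ((1 - beta) ^+ 2 / (4 * L * sigma0 ^+ 2)).
    by rewrite ler_wpM2l// ltW// (mulr_gt0 (mulr_gt0 sigma_gt0 hL)).
  have -> : sigma * L * sigma * ((1 - beta) ^+ 2 / (4 * L * sigma0 ^+ 2)) =
      4^-1.
    by rewrite /sigma; field; rewrite !gt_eqF.
  by rewrite /eta !mulrA.
have eta_r : 2 * eta <= r.
  apply: le_trans hr.
  have := ler_wpM2l (mulr_ge0 (ler0n _ 2) (ltW sigma_gt0)) hC2.
  have -> : 2 * sigma * ((1 - beta) ^+ 2 / (4 * L * sigma0 ^+ 2)) =
    (1 - beta) / (2 * sigma0 * L).
    by rewrite /sigma; field; rewrite !gt_eqF.
  by rewrite /eta mulrA.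
have h0 : enorm (B *m KKT f g z0) <= eta.
  by apply: le_trans (hB _) _; rewrite ler_wpM2l// ltW.
have Bu : B \in unitmx by rewrite unitmx_inv.
(* As [eta <= r / 2], the distance is at most [3 / 4 * r + r], below [2 * r], so the Lipschitz
   hypothesis on [KKT'] applies. *)
have dom y : enorm (y - z0) <= 3 / 2 * eta -> dist Sigma y < 2 * r.
  move=> hy; apply: le_lt_trans (dist_le _ Szs) _.
  by apply: le_lt_trans (ler_enorm_dist _ z0 _) _; lra.
(* On the ball of radius [s * eta] the derivative differs from [A] by at most [L * s * eta];
   multiplying by [sigma] gives [s / 4]. *)
have contr s z w : 0 <= s <= 3 / 2 ->
    enorm (z - z0) <= s * eta -> enorm (w - z0) <= s * eta ->
    enorm ((z - w) - B *m (KKT f g z - KKT f g w)) <= s / 4 * enorm (z - w).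
  move=> /andP[s_ge0 s_le] zr wr.
  have mv := mean_value_vector (A := A) (K := L * (s * eta))
    (is_derive_KKT hf hg _ _) zr wr.
  have -> : z - w - B *m (KKT f g z - KKT f g w) =
      - (B *m (KKT f g z - KKT f g w - A *m (z - w))).
    by rewrite [in RHS]mulmxBr /B mulKmx// opprB.
  rewrite enormN; apply: le_trans (hB _) _.
  have {mv}h : enorm (KKT f g z - KKT f g w - A *m (z - w)) <=
      L * (s * eta) * enorm (z - w).
    apply: mv => y hy; apply: le_trans (enorm_mulmx_le _ _) _.
    rewrite ler_wpM2r ?enorm_ge0//.
    have y32 : enorm (y - z0) <= 3 / 2 * eta.
      by apply: le_trans hy _; rewrite ler_wpM2r.
    have z32 : enorm (z0 - z0) <= 3 / 2 * eta by rewrite subrr enorm0 mulr_ge0.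
    apply: le_trans (hF _ _ (dom _ y32) (dom _ z32)) _.
    by rewrite ler_wpM2l// ltW.
  apply: le_trans (ler_wpM2l (ltW sigma_gt0) h) _.
  rewrite mulrA ler_wpM2r ?enorm_ge0//.
  by have := ler_wpM2l s_ge0 hs; lra.
have [|zstar [Hz _ hz]] := newton_converges Bu h0; last by exists zstar.
move=> s q; rewrite !inE => /orP[]/eqP[-> ->] z w zr wr.
  have := contr 1 z w _ zr wr; rewrite mul1r; apply; lra.
have c : enorm (z - w - B *m (KKT f g z - KKT f g w)) <= 3 / 2 / 4 * enorm (z - w).
  by apply: contr => //; lra.
by have := enorm_ge0 (z - w); lra.
Qed.

End ModifiedNewton.

(** * Combination of the two phases *)

Unset Implicit Arguments.
Set Strict Implicit.

Theorem theorem3 (R : realType) (n m : nat) (hmn : (m < n)%N)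
    (f : 'cV[R]_n -> R) (g : 'cV[R]_n -> 'cV[R]_m)
    (L0 L1 rad : R)
    (hf : C2_lipschitz f)
    (hg : forall i : 'I_m, C2_lipschitz (component g i))
    (hL0 : 0 < L0)
    (hfL0 : forall x y : 'cV[R]_n, `|f x - f y| <= L0 * enorm (x - y))
    (hL1 : 0 < L1)
    (hfL1 : lipschitz_wrt enorm enorm setT L1 (grad f))
    (hScompact : compact (feasible g))
    (hSmanifold : manifold_without_boundary (n - m) (feasible g))
    (hSrank : forall x, feasible g x -> \rank (jac g x) = m)
    (hrad : 0 < rad)
    (hSprox : proximally_smooth (feasible g) rad)
    (hOmega : finite_set (stationary f g))
    (hnondeg : nondegenerate_problem f g)
    (mu : R) (hmu : 0 < mu) (hTEB : tangent_error_bound f g mu)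
    (d Llam L1Fx : R) (hd : 0 < d)
    (hlam : lipschitz_wrt enorm enorm
       [set x | feasible g x /\ dist (stationary f g) x < d]
       Llam (multiplier f g))
    (hL1Fx : 0 < L1Fx)
    (hFx : lipschitz_wrt enorm opnorm
       [set x | feasible g x /\ dist (stationary f g) x < d]
       L1Fx (fun x => KKT' f g (lift_multiplier f g x)))
    (r : R) (hr : r = d * Num.sqrt (1 + Llam ^+ 2))
    (L1F : R) (hL1F : 0 < L1F)
    (hF : lipschitz_wrt enorm opnorm
       [set z | dist (lift_multiplier f g @` stationary f g) z < 2 * r]
       L1F (KKT' f g))
    (sigma0 beta : R) (hsigma0 : 0 < sigma0) (hbeta : 0 < beta < 1)
    (hinv : forall x, stationary f g x ->
       opnorm (invmx (KKT' f g (lift_multiplier f g x))) <= sigma0)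
    (hbetad : beta <= L1Fx * sigma0 * d)
    (hradius : (1 - beta) / (2 * sigma0 * L1F) <= r)
    (* only in the borderline case of hbetad: the conditions hlam and hFx also
       hold on the closed d-neighborhood *)
    (hborder : beta = L1Fx * sigma0 * d ->
       lipschitz_wrt enorm enorm
         [set x | feasible g x /\ dist (stationary f g) x <= d]
         Llam (multiplier f g) /\
       lipschitz_wrt enorm opnorm
         [set x | feasible g x /\ dist (stationary f g) x <= d]
         L1Fx (fun x => KKT' f g (lift_multiplier f g x)))
    (C : R)
    (hC : C = Num.min (mu * beta / (L1Fx * sigma0))
                      ((1 - beta) ^+ 2 / (4 * L1F * sigma0 ^+ 2)))
    (gamma : R) (hgamma : 0 < gamma < Num.min (1 / L1) (rad / L0))
    (x0 : 'cV[R]_n) (hx0 : feasible g x0) :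
  let x := grad_proj_seq f g gamma x0 in
  let Df := f x0 - inf [set f y | y in feasible g] in
  let N1 := natceil (2 * Df * (1 + gamma * L1) ^+ 2
                       / (C ^+ 2 * gamma * (1 - gamma * L1))) in
  let N2 := fun eps : R =>
    (natceil (log2 (C * sigma0 / (eps * (1 - beta)))) + 1)%N in
  forall switch : nat -> Prop,
    switch = switch_grad f g C x \/ switch = switch_step gamma L1 C x ->
  exists K : nat,
    let z := newton_seq f g (lift_multiplier f g (x K)) in
    let xh := fun j => usubmx (z j) in
    [/\ (* Phase 1 is well defined and stops at K *)
        forall k, (k < K)%N ->
          nearest (feasible g) (x k - gamma *: grad f (x k)) = [set x k.+1],
        (forall k, (k < K)%N -> ~ switch k) /\ switch K,
        (* Phase 2 is well defined and converges *)
        KKT' f g (z 0%N) \in unitmx,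
        exists2 xstar, stationary f g xstar & xh j @[j --> \oo] --> xstar
      & (K <= N1)%N /\
        forall eps : R, 0 < eps ->
          (forall j, (N2 eps <= j)%N -> dist (stationary f g) (xh j) <= eps) /\
          (forall t, (N1 + N2 eps <= t)%N ->
             dist (stationary f g) (combined_seq K x xh t) <= eps)].
Proof.
have /andP[hbeta0 hbeta1] := hbeta.
have C_gt0 : 0 < C.
  by rewrite hC lt_min !divr_gt0 ?mulr_gt0 ?exprn_gt0// subr_gt0.
move=> x Df N1 N2 switch hswitch.
have [K [KN sK nsK hK]] := phase1 hf hg hL0 hfL0 hL1 hfL1 hScompact hSrank
  hSprox hgamma hx0 C_gt0 hswitch.
have gx k : feasible g (x k).
  exact: (feasible_grad_proj_seq hf hL0 hfL0 hScompact hSprox hgamma hx0).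
have [xs [sxs dxs]] := nearest_exists (x K) (finite_compact hOmega)
  (stationary_exists hf hg hL0 hfL0 hL1 hfL1 hScompact hSrank hSprox hgamma
     (ex_intro _ x0 hx0)).
have gxs : feasible g xs by case: sxs.
set D := dist _ _ in dxs.
have D0 : 0 <= D by exact: dist_ge0.
have Ls0 : 0 < L1Fx * sigma0 by rewrite mulr_gt0.
(* The error bound turns the switching bound and the first entry of [C] into closeness to the
   stationary point [xs]. *)
have DLs : D * (L1Fx * sigma0) <= beta.
  rewrite -(ler_pM2l hmu) (mulrA mu) -(ler_pdivlMr _ _ Ls0).
  apply: le_trans (hTEB _ (gx K)) _; apply: le_trans hK _.
  by rewrite hC ge_min lexx.
have [Dlam DFx] : enorm (multiplier f g (x K) - multiplier f g xs) <= Llam * D /\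
    opnorm (KKT' f g (lift_multiplier f g (x K)) - KKT' f g (lift_multiplier f g xs))
      <= L1Fx * D.
  have dxs0 := dist_mem sxs.
  have [Dd|dD] := ltP D d.
    rewrite -dxs; split; [apply: hlam|apply: hFx] => //; split => //;
      by rewrite dxs0.
  (* [DLs] and [hbetad] give [D <= d], so [d <= D] forces equality in [hbetad], and the estimates on
     the closed neighborhood apply. *)
  have border : beta = L1Fx * sigma0 * d.
    apply/eqP; rewrite eq_le hbetad/= (le_trans _ DLs)// mulrC.
    by rewrite ler_wpM2r// ltW.
  have Dd : D <= d by rewrite -(ler_pM2r Ls0) (le_trans DLs)// border mulrC.
  have [hlam' hFx'] := hborder border.
  by rewrite -dxs; split; [apply: hlam'|apply: hFx'] => //; split => //;
    rewrite dxs0 ltW.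
have Dd : D <= d by rewrite -(ler_pM2r Ls0) (le_trans DLs)// mulrC.
have r0 : 0 < r by rewrite hr mulr_gt0// sqrtr_gt0 ltr_wpDr// sqr_ge0.
(* The squared norm is at most [D ^+ 2 * (1 + Llam ^+ 2)], which explains the form of [r]. *)
have z0zs : enorm (lift_multiplier f g (x K) - lift_multiplier f g xs) <= r.
  rewrite -ler_sqr ?nnegrE ?enorm_ge0 ?(ltW r0)// opp_col_mx add_col_mx enorm_col_mx.
  rewrite dxs hr exprMn [X in _ <= _ * X]sqr_sqrtr ?addr_ge0 ?sqr_ge0// mulrDr mulr1.
  have hd2 : D ^+ 2 <= d ^+ 2 by rewrite ler_sqr ?nnegrE ?(ltW hd).
  rewrite lerD//.
  have : enorm (multiplier f g (x K) - multiplier f g xs) ^+ 2 <= (Llam * D) ^+ 2.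
    by rewrite ler_sqr ?nnegrE ?enorm_ge0// (le_trans (enorm_ge0 _) Dlam).
  by move/le_trans; apply; rewrite exprMn mulrC ler_wpM2r// sqr_ge0.
have hb1 : 0 <= beta < 1 by rewrite (ltW hbeta0).
have DFx' : opnorm (KKT' f g (lift_multiplier f g (x K)) -
    KKT' f g (lift_multiplier f g xs)) <= beta / sigma0.
  by rewrite (le_trans DFx)// ler_pdivlMr// mulrAC mulrC.
have C2 : C <= (1 - beta) ^+ 2 / (4 * L1F * sigma0 ^+ 2).
  by rewrite hC ge_min lexx orbT.
have hK0 : enorm (KKT f g (lift_multiplier f g (x K))) <= C by rewrite KKT_lift.
have Szs : (lift_multiplier f g @` stationary f g) (lift_multiplier f g xs).
  by exists xs.
have [uz0 [zstar Fz hz]] := phase2 hf hg Szs z0zs r0 hsigma0 hb1 hL1F (ltW C_gt0)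
  (hnondeg.1 _ sxs) (hinv _ sxs) DFx' hF hradius hK0 C2.
exists K => z xh.
have sstar := stationary_KKT hSrank Fz.
have bound eps : 0 < eps -> forall j, (N2 eps <= j)%N ->
    enorm (xh j - usubmx zstar) <= eps.
  move=> eps0 j; rewrite /N2; set T := C * sigma0 / _ => Nj.
  have T0 : 0 < T by rewrite divr_gt0// mulr_gt0// subr_gt0.
  have hT := log2_le_natceil T0; set N := natceil _ in hT Nj.
  have -> : xh j - usubmx zstar = usubmx (z j - zstar) by rewrite linearB.
  apply: le_trans (enorm_usubmx _) _; apply: le_trans (hz j) _.
  (* [T] is the initial Newton error scale in units of [eps]. *)
  have -> : sigma0 / (1 - beta) * C = T * eps.
    by rewrite /T; field; rewrite !gt_eqF// subr_gt0.
  rewrite mulrA -[leRHS]mul1r ler_wpM2r ?(ltW eps0)//.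
  by apply: halving_bound hT; [rewrite -addn1|exact: ltW].
have near eps : 0 < eps -> forall j, (N2 eps <= j)%N ->
    dist (stationary f g) (xh j) <= eps.
  by move=> eps0 j Nj; apply: le_trans (dist_le _ sstar) _; exact: bound.
split=> //.
- by move=> k _; apply: (nearest_step hf hL0 hfL0 hScompact hSprox hgamma).
- exists (usubmx zstar) => //; apply: enorm_cvgP => e e0.
  by exists (N2 e) => // j; exact: bound.
split=> // eps eps0; split; first exact: near.
(* Since [K <= N1], at least [N2 eps] of the [t] steps belong to Phase 2. *)
move=> t ht; have Kt : (K <= t)%N.
  by apply: leq_trans KN _; apply: leq_trans ht; exact: leq_addr.
rewrite /combined_seq ltnNge Kt /=; apply: near => //.
by rewrite leq_subRL// (leq_trans _ ht)// leq_add2r.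
Qed.
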